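(* Let $X$ be a separable Banach space and, for $\eta\in[0,1]$, let $h_\eta:\mathbb{R}\times\Omega\times X\to X$ be such that for each $\omega_\tau\in\mathbb{R}\times\Omega$ the map $z\mapsto h_\eta(\omega_\tau,z)$ is continuously differentiable. Consider $$\dot z=A_\eta(\Theta_t\omega_\tau)z+h_\eta(\Theta_t\omega_\tau,z),\qquad\omega_\tau\in\mathbb{R}\times\Omega,\qquad (\ast)_\eta$$ where $A_\eta(\omega_\tau)=A+B_\eta(\omega_\tau)$, $A$ generates a $C^0$-semigroup on $X$, $B_\eta(\omega_\tau)\in\mathcal{L}(X)$, $B_0=0$ (so that $A_0(\Theta_t\omega_\tau)=A$), and $\lim_{\eta\to0}\sup_{t\in\mathbb{R}}\|B_\eta(\Theta_t\omega_\tau)\|_{\mathcal{L}(X)}=0$ for every $\omega_\tau$. Assume that $h_\eta(\omega_\tau,0)=0$ and $(h_\eta)_x(\omega_\tau,0)=0\in\mathcal{L}(X)$ for all $\eta,\omega_\tau$; that $h_0:X\to X$ does not depend on $\omega_\tau$; that for all $r>0$ and $\omega_\tau\in\mathbb{R}\times\Omega$ $$\lim_{\eta\to0}\ \sup_{(t,x)\in\mathbb{R}\times B(0,r)}\Big\{\|h_\eta(\Theta_t\omega_\tau,x)-h_0(x)\|_X+\|(h_\eta)_x(\Theta_t\omega_\tau,x)-h_0'(x)\|_{\mathcal{L}(X)}\Big\}=0;$$ and that $z_0^*=0$ is a hyperbolic solution of $(\ast)_0$. Then, given $\epsilon_0>0$ sufficiently small, the following hold. (1) There exists a $\Theta$-invariant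 function $\eta_0:\mathbb{R}\times\Omega\to(0,1]$ such that, for each $\omega_\tau$ and each $\eta\in(0,\eta_0(\omega_\tau)]$, $z_\eta^*=0$ is a hyperbolic solution of $(\ast)_\eta$. In particular, the linear evolution process $\{\varphi_\eta(t-s,\Theta_s\omega_\tau):t\ge s\}$ associated with the linear part of $(\ast)_\eta$ admits an exponential dichotomy with family of projections $\{\Pi^u_\eta(s):s\in\mathbb{R}\}$. (2) The families of projections $\Pi^u_\eta=\{\Pi^u_\eta(s):s\in\mathbb{R}\}$, $\eta\in(0,\eta_0(\omega_\tau)]$, satisfy $$\lim_{\eta\to0}\sup_{t\in\mathbb{R}}\|\Pi^u_\eta(t)-\Pi^u_0\|_{\mathcal{L}(X)}=0.$$ (3) There exists a $\Theta$-invariant function $\delta_0:\mathbb{R}\times\Omega\to(0,+\infty)$, independent of $\eta$, such that for each $\omega_\tau$ and $\eta\in[0,\eta_0(\omega_\tau)]$ there is a map $$\mathbb{R}\times B_X(0,\delta_0(\omega_\tau))\ni(s,z)\mapsto\Sigma^u_\eta(s,z):=\Sigma^u_\eta(s,\Pi^u_\eta(s)z)$$ with the property: given $\delta\in(0,\delta_0(\omega_\tau))$ there exist $0<\delta''<\delta'<\delta$ such that, for every $s\in\mathbb{R}$, $$\{\Pi^u_\eta(s)z+\Sigma^u_\eta(s,\Pi^u_\eta(s)z):\|z\|_X\le\delta''\}\subset W^{u,\delta'}_\eta(0)(s)\subset\{\Pi^u_\eta(s)z+\Sigma^u_\eta(s,\Pi^u_\eta(s)z):\|z\|_X\le\delta\}.$$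 (4) For each fixed $\omega_\tau$, the family of graphs of the maps $\{\Sigma^u_\eta\}_{\eta\in(0,\eta_0(\omega_\tau)]}$ behaves continuously at $\eta=0$: for every $s\in\mathbb{R}$, $$\sup_{t\le s}\ \sup_{\|z\|_X\le\delta_0(\omega_\tau)}\Big\{\|\Pi^u_\eta(t)-\Pi^u_0\|_{\mathcal{L}(X)}+\|\Sigma^u_\eta(t,\Pi^u_\eta(t)z)-\Sigma^u_0(\Pi^u_0z)\|_X\Big\}\longrightarrow0\quad\text{as }\eta\to0.$$
   Context: **Driving flow.** $(\Omega,\mathcal{F},\mathbb{P})$ is a probability space and $\{\theta_t:\Omega\to\Omega\}_{t\in\mathbb{R}}$ a random flow: $\theta_0=Id_\Omega$, $\theta_{t+s}=\theta_t\circ\theta_s$, each $\theta_t$ measurable. Write $\omega_\tau=(\tau,\omega)\in\mathbb{R}\times\Omega$ and $\Theta_t(\omega_\tau)=(t+\tau,\theta_t\omega)$. A function $M$ on $\mathbb{R}\times\Omega$ is $\Theta$-invariant if $M(\Theta_t\omega_\tau)=M(\omega_\tau)$ for all $t\in\mathbb{R}$ and all $\omega_\tau$. **Solutions.** The problems $(\ast)_\eta$ are assumed globally well-posed in the mild sense (in particular the dependence of $B_\eta(\Theta_t\omega_\tau)$ and $h_\eta(\Theta_t\omega_\tau,\cdot)$ on $t$ is regular enough for the integral equations to make sense) and to generate a cocycle $\psi_\eta(t,\omega_\tau):X\to X$, $t\ge0$, with $\psi_\eta(0,\omega_\tau)=Id_X$, $\psi_\eta(t+s,\omega_\tau)=\psi_\eta(t,\Theta_s\omega_\tau)\psi_\eta(s,\omega_\tau)$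 and $(t,x)\mapsto\psi_\eta(t,\omega_\tau)x$ continuous. For fixed $\omega_\tau$, $\{\psi_\eta(t-s,\Theta_s\omega_\tau):t\ge s\}$ is an evolution process. A global solution of an evolution process $\{S(t,s):t\ge s\}$ is a map $\zeta:\mathbb{R}\to X$ with $S(t,s)\zeta(s)=\zeta(t)$ for all $t\ge s$. The linear part generates the linear evolution process given by $$\varphi_\eta(t-s,\Theta_s\omega_\tau)=e^{A(t-s)}+\int_s^te^{A(t-r)}B_\eta(\Theta_r\omega_\tau)\varphi_\eta(r-s,\Theta_s\omega_\tau)\,dr,\quad t\ge s.$$ **Exponential dichotomy and hyperbolicity.** A linear evolution process $\{\varphi(t,s):t\ge s\}\subset\mathcal{L}(X)$ admits an exponential dichotomy if there are projections $\Pi^s(t)$, with $\Pi^u(t)=Id_X-\Pi^s(t)$, and constants $M\ge1$, $\alpha>0$ such that $\Pi^s(t)\varphi(t,s)=\varphi(t,s)\Pi^s(s)$, $\varphi(t,s):R(\Pi^u(s))\to R(\Pi^u(t))$ is an isomorphism for $t\ge s$ (with inverse denoted $\varphi(s,t)$), $\|\varphi(t,s)\Pi^s(s)\|\le Me^{-\alpha(t-s)}$ for $t\ge s$ and $\|\varphi(t,s)\Pi^u(s)\|\le Me^{\alpha(t-s)}$ for $t\le s$. The zero solution of $(\ast)_\eta$ (for a given $\omega_\tau$) is hyperbolic if the linear process $\{\varphi_\eta(t-s,\Theta_s\omega_\tau):t\ge s\}$ admits an exponential dichotomy; for $\eta=0$ this means that $\{e^{At}\}$ does, with time-independent projection $\Pi^u_0$.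 Projections and maps $\Sigma^u_\eta$ depend on the fixed $\omega_\tau$, which is omitted in the notation; $\Sigma^u_0$ does not depend on $s$. The values of $\Sigma^u_\eta(s,\cdot)$ lie in the range of $Id_X-\Pi^u_\eta(s)$. **Local unstable set.** For fixed $\omega_\tau$ and a number $\delta'>0$, $W^{u,\delta'}_\eta(0)(s)$ is the set of $z\in X$ for which there is a global solution $\zeta$ of $\{\psi_\eta(t-r,\Theta_r\omega_\tau):t\ge r\}$ with $\zeta(s)=z$, $\|\zeta(r)\|_X\le\delta'$ for all $r\le s$, and $\|\zeta(r)\|_X\to0$ as $r\to-\infty$. $B_X(0,r)$, $B(0,r)$ denote the closed ball of radius $r$ in $X$. *)

(* Defs.v *)
From HB Require Import structures.
From mathcomp Require Import all_boot all_order all_algebra.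
From mathcomp Require Import all_classical all_reals all_analysis.
From mathcomp Require Import measurable_realfun.
Set Implicit Arguments.
Unset Strict Implicit.
Unset Printing Implicit Defensive.
Import Order.TTheory GRing.Theory Num.Theory.
Import numFieldNormedType.Exports.
Local Open Scope classical_set_scope.
Local Open Scope ring_scope.

Definition separable_space (T : topologicalType) : Prop :=
  exists D : set T, countable D /\ dense D.

Definition bounded_linear (R : realType) (X : normedModType R)
    (f : X -> X) : Prop := linear f /\ continuous f.

(* Valued in \bar R: a map that is unbounded on the unit ball has norm +oo
   instead of the junk value of a real supremum. *)
Definition opnorm (R : realType) (X : normedModType R) (f : X -> X) : \bar R :=
  ereal_sup [set `|f x|%:E | x in [set x : X | `|x| <= 1]].

Definition C1 (R : realType) (X : normedModType R) (f : X -> X) : Prop :=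
  (forall z : X, differentiable f z) /\
  (forall z : X,
     opnorm (fun x => 'd f y x - 'd f z x) @[y --> z] --> (0 : \bar R)).

(* Bochner integral with respect to Lebesgue measure: v is the limit of the
   integrals of simple maps s_n = \sum_i \1_(E n i) *: c n i approximating f
   in L^1(D).  As `|f - s_n| may be Lebesgue but not Borel measurable,
   \int_D `|f - s_n| --> 0 is expressed through Borel majorants g n. *)
Definition is_bochner_integral (R : realType) (X : normedModType R)
    (D : set R) (f : R -> X) (v : X) : Prop :=
  let mu := @lebesgue_measure R in
  exists (m : nat -> nat) (E : nat -> nat -> set R) (c : nat -> nat -> X)
         (g : nat -> R -> \bar R),
  [/\ forall n i,
        [/\ measurable (E n i), E n i `<=` D & (mu (E n i) < +oo)%E],
      forall n, measurable_fun D (g n) /\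
        (forall t, D t ->
           (`|f t - \sum_(i < m n) (\1_(E n i) t : R) *: c n i|%R%:E
            <= g n t)%E),
      (\int[mu]_(t in D) g n t)%E @[n --> \oo] --> (0 : \bar R)
    & (\sum_(i < m n) fine (mu (E n i)) *: c n i) @[n --> \oo] --> v].

Definition C0_semigroup (R : realType) (X : normedModType R)
    (T : R -> X -> X) : Prop :=
  [/\ forall t, 0 <= t -> bounded_linear (T t),
      forall x, T 0 x = x,
      forall t s x, 0 <= t -> 0 <= s -> T (t + s) x = T t (T s x)
    & forall x, T t x @[t --> 0^'+] --> x].

Definition generator (R : realType) (X : normedModType R)
    (domA : set X) (A : X -> X) (T : R -> X -> X) : Prop :=
  domA = [set x | cvg (t^-1 *: (T t x - x) @[t --> (0 : R)^'+])] /\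
  (forall x, domA x -> t^-1 *: (T t x - x) @[t --> (0 : R)^'+] --> A x).

Definition random_flow (R : realType) (d : measure_display)
    (Omega : measurableType d) (theta : R -> Omega -> Omega) : Prop :=
  [/\ forall o, theta 0 o = o,
      forall t s o, theta (t + s) o = theta t (theta s o)
    & forall t, measurable_fun [set: Omega] (theta t)].

Definition Theta (R : realType) (Omega : Type) (theta : R -> Omega -> Omega)
    (t : R) (w : R * Omega) : R * Omega := (t + w.1, theta t w.2).

Definition Theta_invariant (R : realType) (Omega : Type)
    (theta : R -> Omega -> Omega) (f : R * Omega -> R) : Prop :=
  forall t w, f (Theta theta t w) = f w.

Definition cocycle (R : realType) (Omega : Type) (X : normedModType R)
    (theta : R -> Omega -> Omega) (psi : R -> R * Omega -> X -> X) : Prop :=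
  [/\ forall w x, psi 0 w x = x,
      forall t s w x, 0 <= t -> 0 <= s ->
        psi (t + s) w x = psi t (Theta theta s w) (psi s w x)
    & forall w, {within [set p : R * X | 0 <= p.1],
                 continuous (fun p : R * X => psi p.1 w p.2)}].

(* process psi w t s is the evolution operator from time s to time t; it is
   only meaningful for s <= t. *)
Definition process (R : realType) (Omega : Type) (X : Type)
    (theta : R -> Omega -> Omega) (psi : R -> R * Omega -> X -> X)
    (w : R * Omega) (t s : R) : X -> X :=
  psi (t - s) (Theta theta s w).

(* u is a mild solution on [0, +oo[ of
   z' = A z + B (Theta_t w) z + h (Theta_t w, z), z(0) = x, where T = e^{At}. *)
Definition mild_solution (R : realType) (Omega : Type) (X : normedModType R)
    (theta : R -> Omega -> Omega) (T : R -> X -> X)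
    (B h : R * Omega -> X -> X) (w : R * Omega) (x : X) (u : R -> X) : Prop :=
  {within [set t : R | 0 <= t], continuous u} /\
  (forall t, 0 <= t ->
     is_bochner_integral `[0, t]
       (fun r => T (t - r) (B (Theta theta r w) (u r)
                            + h (Theta theta r w) (u r)))
       (u t - T t x)).

Definition mild_well_posed (R : realType) (Omega : Type) (X : normedModType R)
    (theta : R -> Omega -> Omega) (T : R -> X -> X)
    (B h : R * Omega -> X -> X) (psi : R -> R * Omega -> X -> X) : Prop :=
  forall w x,
    mild_solution theta T B h w x (fun t => psi t w x) /\
    (forall u, mild_solution theta T B h w x u ->
       forall t, 0 <= t -> u t = psi t w x).

(* The operator-valued integral equation is understood pointwise on X, since
   t |-> e^{At} is in general only strongly continuous. *)
Definition linear_part (R : realType) (Omega : Type) (X : normedModType R)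
    (theta : R -> Omega -> Omega) (T : R -> X -> X)
    (B : R * Omega -> X -> X) (phi : R -> R * Omega -> X -> X) : Prop :=
  [/\ forall t w, 0 <= t -> bounded_linear (phi t w),
      cocycle theta phi
    & forall w s t x, s <= t ->
        is_bochner_integral `[s, t]
          (fun r => T (t - r) (B (Theta theta r w) (process theta phi w r s x)))
          (process theta phi w t s x - T (t - s) x)].

(* Pu is the family of unstable projections, the stable ones being
   x |-> x - Pu t x.  The inverse of S t s : range (Pu s) -> range (Pu t) is
   'pinv_(fun=> 0) (range (Pu s)) (S t s); its boundedness is part of the last
   estimate. *)
Definition exp_dichotomy (R : realType) (X : normedModType R)
    (S : R -> R -> X -> X) (Pu : R -> X -> X) : Prop :=
  (forall t, bounded_linear (Pu t) /\ (forall x, Pu t (Pu t x) = Pu t x)) /\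
  exists M alpha : R, [/\ 1 <= M, 0 < alpha
    & forall s t, s <= t ->
      [/\ forall x, S t s x - Pu t (S t s x) = S t s (x - Pu s x),
          set_bij (range (Pu s)) (range (Pu t)) (S t s),
          (opnorm (fun x => S t s (x - Pu s x)%R)
             <= (M * expR (- alpha * (t - s)))%R%:E)%E
        & (opnorm ('pinv_(fun=> 0%R) (range (Pu s)) (S t s) \o Pu t)
             <= (M * expR (alpha * (s - t)))%R%:E)%E]].

Definition global_solution (R : realType) (X : Type)
    (S : R -> R -> X -> X) (zeta : R -> X) : Prop :=
  forall s t, s <= t -> S t s (zeta s) = zeta t.

Definition local_unstable_set (R : realType) (X : normedModType R)
    (S : R -> R -> X -> X) (delta : R) (s : R) : set X :=
  [set z | exists zeta : R -> X,
    [/\ global_solution S zeta, zeta s = z,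
        forall r, r <= s -> `|zeta r| <= delta
      & zeta r @[r --> -oo] --> (0 : X)]].

Definition graph_over (R : realType) (X : normedModType R)
    (P Sigma : X -> X) (delta : R) : set X :=
  [set P z + Sigma (P z) | z in [set z : X | `|z| <= delta]].

(* Main.v *)
Require Import Defs.
From HB Require Import structures.
From mathcomp Require Import all_boot all_order all_algebra.
From mathcomp Require Import all_classical all_reals all_analysis.
From mathcomp Require Import measurable_realfun.
From mathcomp Require Import ring lra zify.
Set Implicit Arguments.
Unset Strict Implicit.
Unset Printing Implicit Defensive.
Import Order.TTheory GRing.Theory Num.Theory.
Import numFieldNormedType.Exports.
Local Open Scope classical_set_scope.
Local Open Scope ring_scope.

(** Time is cut into steps of a length [tau] so large that the map [L = T tau] of
    the unperturbed semigroup contracts the stable space, and its inverse the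
    unstable one, by a factor 1/16 ([hyperbolic_time_step]).  Only two facts
    about the differential equations are used after that.  A step of the linear
    process, whatever time it starts from, is close to [L]; and on a small ball a
    step of the nonlinear process differs from [L] by a map with a small
    Lipschitz constant.  Moreover both steps tend, uniformly in the starting
    time, to the steps of the unperturbed equation.  Over a time [tau], these
    facts follow from the variation of constants formula by absorbing the
    maximum of a difference of solutions into itself ([duhamel_compare],
    [linear_part_near_map], [mild_near_map_on_ball], [mild_close]); about Bochner
    integrals this takes one inequality ([bochner_dist_le]), and about the
    nonlinearity the mean value inequality ([mean_value_ball]).

    One device produces the projections and the graphs.  Let g_k, k in Z, be maps
    with small Lipschitz constants and z a vector.  There is exactly one bounded
    sequence with y_(k+1) = L y_k + g_k (y_k), except that z is added on arrival
    at k = 0: computing stable components from the past and unstable ones from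
    the future is a contraction.  This kicked orbit decays like 2^-|k|, and it
    depends continuously on z and on the maps g_k ([kicked_orbit_exists],
    [kicked_orbit_decay], [kicked_orbit_unique], [kicked_orbit_stable]).

    For the steps of the linear process, y_0 has a bounded future and y_0 - z,
    the position before the kick, a bounded past.  So z = y_0 - (y_0 - z) is the
    splitting of z into a stable and an unstable part.  Uniqueness makes the
    projections linear, idempotent and invariant, and the decay gives the rates:
    this is the exponential dichotomy ([near_map_dichotomy]).

    For the unstable set, the nonlinear steps, cut off outside a ball, are used
    before time 0 and the linear ones from then on, and the kick is minus the
    unstable part of z.  The position before the kick has a nonlinear past that
    tends to 0, while y_0 is stable because of its linear bounded future; hence
    that position has the unstable part of z as its own, and y_0 as its stable
    part.  So y_0, as a function of z, has the local unstable set as its graph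
    ([graph_sub_local_unstable], [local_unstable_sub_graph]).

    Continuity at [eta = 0] of the projections and of the graphs, uniformly in
    time, is the continuous dependence of kicked orbits ([unstable_proj_close],
    [unstable_graph_close]).  Finally [eta0] is a choice determined by a property
    of the whole orbit of [w], which makes it invariant ([tame_threshold]), and
    [delta0] is a constant: it comes from the unperturbed equation. *)

(** * Identities in additive groups *)

Module ZmodIdentity.

(** Proof by reflection: an expression is determined by the integer coefficients
    of its atoms, and those are compared by computation. *)
Inductive expr := Var of nat | Zero | Opp of expr | Add of expr & expr.

Fixpoint eval (V : zmodType) (e : seq V) (t : expr) : V :=
  match t with
  | Var n => nth 0 e n
  | Zero => 0
  | Opp t => - eval e t
  | Add t u => eval e t + eval e u
  end.

Fixpoint coef (t : expr) (i : nat) : int :=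
  match t with
  | Var n => (i == n)%:Z
  | Zero => 0
  | Opp t => - coef t i
  | Add t u => coef t i + coef u i
  end.

Lemma evalE (V : zmodType) (e : seq V) t :
  eval e t = \sum_(i < size e) nth 0 e i *~ coef t i.
Proof.
elim: t => [n||t ih|t iht u ihu] /=.
- have [ne|ne] := ltnP n (size e).
    rewrite (bigD1 (Ordinal ne))//= eqxx mulr1z big1 ?addr0// => i.
    by move=> /negPf; rewrite -val_eqE/= => ->; rewrite mulr0z.
  rewrite nth_default// big1// => i _.
  by rewrite (ltn_eqF (leq_trans (ltn_ord i) ne)) mulr0z.
- by rewrite big1// => i _; rewrite mulr0z.
- by rewrite ih -sumrN; apply: eq_bigr => i _; rewrite mulrNz.
- by rewrite iht ihu -big_split; apply: eq_bigr => i _; rewrite mulrzDr.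
Qed.

Lemma evalP (V : zmodType) (e : seq V) t u :
  all (fun i => coef t i == coef u i) (iota 0 (size e)) ->
  eval e t = eval e u.
Proof.
move=> /allP h; rewrite !evalE; apply: eq_bigr => i _.
by rewrite (eqP (h i _))// mem_iota ltn_ord.
Qed.

(* Occurrences of an atom may differ in the inference paths of their instances,
   so they are compared up to conversion. *)
Ltac index x e :=
  match e with
  | ?y :: _ => let _ := match goal with _ => unify x y end in constr:(0%N)
  | _ :: ?e' => let n := index x e' in constr:(S n)
  end.

Ltac atoms t e :=
  lazymatch t with
  | GRing.zero => e
  | GRing.opp ?a => atoms a e
  | GRing.add ?a ?b => let e1 := atoms a e in atoms b e1
  | _ => match e with
         | _ => let _ := index t e in e
         | _ => constr:(t :: e)
         end
  end.

Ltac quote t e :=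
  lazymatch t with
  | GRing.zero => constr:(Zero)
  | GRing.opp ?a => let q := quote a e in constr:(Opp q)
  | GRing.add ?a ?b =>
      let q := quote a e in let r := quote b e in constr:(Add q r)
  | _ => let n := index t e in constr:(Var n)
  end.

End ZmodIdentity.

(** Proves identities that hold in every abelian group. *)
Ltac zmod_identity :=
  lazymatch goal with
  | |- @eq ?V ?a ?b =>
    let e0 := ZmodIdentity.atoms a (@nil V) in
    let e := ZmodIdentity.atoms b e0 in
    let q := ZmodIdentity.quote a e in
    let r := ZmodIdentity.quote b e in
    exact: (@ZmodIdentity.evalP _ e q r (erefl true))
  end.

(** * Contractions on weighted families *)

Lemma le_of_eq (R : numDomainType) (x y : R) : x = y -> x <= y.
Proof. by move=> ->. Qed.

Section fixpoints.
Context {R : realType} {X : completeNormedModType R}.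

Lemma half_pow_cvg0 (c : R) : c / 2 ^+ n @[n --> \oo] --> (0 : R).
Proof.
rewrite (_ : (fun n => _) = geometric c (2^-1)).
  by apply: cvg_geometric; rewrite ger0_norm// invf_lt1// ltr1n.
by apply/funext => n; rewrite /geometric/= exprVn.
Qed.

Lemma le_of_half_pow (x a c : R) : (forall n, x <= a + c / 2 ^+ n) -> x <= a.
Proof.
move=> h; have hc : a + c / 2 ^+ n @[n --> \oo] --> a + 0.
  by apply: cvgD; [exact: cvg_cst|exact: half_pow_cvg0].
rewrite -[a]addr0; apply: (@closed_cvg _ _ _ _ _ (>= x) _ _ _ hc).
  exact: closed_ge.
by exists 0%N => // n _; exact: h.
Qed.

Lemma geometric_cvg (u : nat -> X) (c : R) :
  (forall n, `|u n - u n.+1| <= c / 2 ^+ n) ->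
  exists l : X, forall n, `|u n - l| <= 2 * c / 2 ^+ n.
Proof.
move=> hu.
have c0 : 0 <= c.
  by have := le_trans (normr_ge0 _) (hu 0%N); rewrite expr0 divr1.
have dist n k : `|u n - u (n + k)%N| <= 2 * c / 2 ^+ n - 2 * c / 2 ^+ (n + k).
  elim: k => [|k ih]; first by rewrite addn0 !subrr normr0.
  rewrite addnS (le_trans (ler_distD (u (n + k)%N) _ _))//.
  apply: (le_trans (lerD ih (hu _))).
  rewrite exprS invfM; lra.
have distle n m : (n <= m)%N -> `|u n - u m| <= 2 * c / 2 ^+ n.
  move=> /subnKC <-; apply: (le_trans (dist _ _)).
  by rewrite gerBl// divr_ge0 ?mulr_ge0// exprn_ge0.
have cg : cvg (u n @[n --> \oo]).
  apply/cauchy_cvgP/cauchy_exP => e e0.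
  have /cvgr0_norm_lt /(_ _ e0)[N _ /(_ N (leqnn _)) hN] := half_pow_cvg0 (2 * c).
  exists (u N), N => // n /= Nn; rewrite -ball_normE /=.
  apply: le_lt_trans hN; apply: (le_trans (distle _ _ Nn)); exact: ler_norm.
exists (lim (u n @[n --> \oo])) => n.
have hc : `|u n - u m| @[m --> \oo] --> `|u n - lim (u n @[n --> \oo])|.
  by apply: cvg_norm; apply: cvgB => //; exact: cvg_cst.
apply: (@closed_cvg _ _ _ _ _ (fun x : R => x <= 2 * c / 2 ^+ n) _ _ _ hc).
  exact: closed_le.
by exists n => // m /= nm; exact: distle.
Qed.

Context {I : Type}.
Implicit Types (y : I -> X) (W : I -> R) (G : (I -> X) -> I -> X).

(** Halving the [W]-weighted distance.  Quantifying over all bounds [c] avoids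
    any norm on families of points of [X], bounded or not. *)
Definition halving W G :=
  forall y y' c, (forall k, `|y k - y' k| <= c * W k) ->
    forall k, `|G y k - G y' k| <= c / 2 * W k.

(** Iteration from 0.  The iterates stay within the weight, so the decay of the
    fixed point along [W] comes with its existence. *)
Lemma halving_fixpoint W G c : (forall k, 0 <= W k <= 1) -> halving W G ->
  (forall k, `|G (fun=> 0) k| <= c * W k) ->
  exists y, G y = y /\ forall k, `|y k| <= 2 * c * W k.
Proof.
move=> hW hG h0.
pose u n := iter n G (fun=> 0).
have hu n k : `|u n k - u n.+1 k| <= c / 2 ^+ n * W k.
  elim: n k => [|n ih] k.
    by rewrite /= sub0r normrN expr0 divr1.
  have := hG _ _ _ ih k; rewrite exprS invfM /=.
  by rewrite -[c / _ / _]mulrA [_^-1 * 2^-1]mulrC.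
have hl k : exists l : X, forall n, `|u n k - l| <= 2 * c / 2 ^+ n * W k.
  have [n|l hl] := @geometric_cvg (u ^~ k) (c * W k).
    by rewrite mulrAC.
  by exists l => n; rewrite (le_trans (hl n))//; apply: le_of_eq; ring.
have [y hy] := choice hl; exists y; split; last first.
  by move=> k; have := hy k 0%N; rewrite /= sub0r normrN expr0 divr1.
apply/funext => k; apply/eqP; rewrite -subr_eq0 -normr_le0.
have c0 : 0 <= c * W k by exact: le_trans (normr_ge0 _) (h0 k).
(* the orbit [u] of 0 tends both to its limit and to the image of its limit *)
have key n : `|G y k - y k| <= 2 * c * W k / 2 ^+ n.
  have h1 : forall j, `|y j - u n j| <= 2 * c / 2 ^+ n * W j.
    by move=> j; rewrite distrC; exact: hy.
  apply: (le_trans (ler_distD (u n.+1 k) _ _)).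
  have h2 := hG _ _ _ h1 k; have h3 := hy k n.+1.
  apply: (le_trans (lerD h2 h3)).
  rewrite exprS invfM; apply: le_of_eq.
  by field; rewrite expf_neq0.
apply: (@le_of_half_pow _ _ (2 * c * W k)) => n; rewrite add0r; exact: key.
Qed.

(** Fixed points of nearby contractions are near each other; with [dlt = 0],
    this is uniqueness of the bounded fixed point. *)
Lemma halving_stable G G' y y' c dlt : halving (fun=> 1) G ->
  G y = y -> G' y' = y' -> (forall k, `|y k - y' k| <= c) ->
  (forall k, `|G y' k - G' y' k| <= dlt) ->
  forall k, `|y k - y' k| <= 2 * dlt.
Proof.
move=> hG Gy Gy' hc hd.
have key n k : `|y k - y' k| <= 2 * dlt + c / 2 ^+ n.
  elim: n k => [|n ih] k.
    have d0 : 0 <= dlt by exact: le_trans (normr_ge0 _) (hd k).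
    by rewrite (le_trans (hc k))// expr0 divr1 lerDr mulr_ge0.
  rewrite -Gy -{1}Gy' (le_trans (ler_distD (G y' k) _ _))//.
  have ih' j : `|y j - y' j| <= (2 * dlt + c / 2 ^+ n) * 1 by rewrite mulr1.
  have h1 := hG _ _ _ ih' k.
  rewrite (le_trans (lerD h1 (hd k)))//.
  by rewrite exprS invfM; apply: le_of_eq; field; rewrite expf_neq0.
by move=> k; exact: (@le_of_half_pow _ _ c) (key^~ k).
Qed.

End fixpoints.

(** * Kicked orbits of perturbations of a hyperbolic map *)

Section linear_maps.
Context {R : pzRingType} {X Y : lmodType R}.
Variables (f : X -> Y) (lf : linear f).

Lemma linear_mapD x y : f (x + y) = f x + f y.
Proof. by have := lf 1 x y; rewrite !scale1r. Qed.
Lemma linear_map0 : f 0 = 0.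
Proof. by apply: (addIr (f 0)); rewrite -linear_mapD !add0r. Qed.
Lemma linear_mapZ a x : f (a *: x) = a *: f x.
Proof. by have := lf a x 0; rewrite linear_map0 !addr0. Qed.
Lemma linear_mapN x : f (- x) = - f x.
Proof. by rewrite -scaleN1r linear_mapZ scaleN1r. Qed.
Lemma linear_mapB x y : f (x - y) = f x - f y.
Proof. by rewrite linear_mapD linear_mapN. Qed.

End linear_maps.

Lemma linear_map_sub (R : pzRingType) (X Y : lmodType R) (f g : X -> Y) :
  linear f -> linear g -> linear (fun x => f x - g x).
Proof. by move=> lf lg a u v; rewrite lf lg scalerBr; zmod_identity. Qed.

Section hyperbolic.
Context {R : realType} {X : completeNormedModType R}.
Implicit Types (g : int -> X -> X) (y : int -> X) (z : X) (W : int -> R).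

(** [Pu] is the unstable projection of [L] and [J] inverts [L] on its range.
    The rate 1/16 is what a large enough power of any hyperbolic map offers. *)
Record hyperbolic_map (L Pu J : X -> X) (p : R) : Prop := HyperbolicMap {
  hyp_linL : linear L;
  hyp_linP : linear Pu;
  hyp_linJ : linear J;
  hyp_PP : forall x, Pu (Pu x) = Pu x;
  hyp_PL : forall x, Pu (L x) = L (Pu x);
  hyp_PJ : forall x, Pu (J x) = J x;
  hyp_LJ : forall x, L (J x) = Pu x;
  hyp_JL : forall x, J (L x) = Pu x;
  hyp_p1 : 1 <= p;
  hyp_Ps : forall x, `|x - Pu x| <= p * `|x|;
  hyp_Ls : forall x, `|L (x - Pu x)| <= 16^-1 * `|x|;
  hyp_Jle : forall x, `|J x| <= 16^-1 * `|x| }.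

(** As [p] bounds the stable projection, the stable part of such a perturbation
    is 1/32-Lipschitz: small enough next to the rate 1/16 of the linear part. *)
Definition small_lipschitz (p : R) g :=
  (forall k, g k 0 = 0) /\
  forall k x x', `|g k x - g k x'| <= (32 * p)^-1 * `|x - x'|.

(** The step from -1 to 0 is the one that ends at time 0. *)
Definition kick z (k : int) : X := if k == - 1 then z else 0.

(** Boundedness on both sides leaves an orbit no choice: it has to be unstable
    before the impulse and stable after it, so that the impulse gets split. *)
Definition kicked_orbit (L : X -> X) g z : set (int -> X) :=
  [set y | (exists c, forall k, `|y k| <= c) /\
           forall k, y (k + 1) = L (y k) + g k (y k) + kick z k].

Variables (L Pu J : X -> X) (p : R).
Hypothesis hyp : hyperbolic_map L Pu J p.

Let linL := hyp_linL hyp.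
Let linP := hyp_linP hyp.
Let linJ := hyp_linJ hyp.
Let p1 := hyp_p1 hyp.
Let p0 : 0 < p. Proof. exact: lt_le_trans p1. Qed.

(** Stable components are computed from the past and unstable ones from the
    future: this is what makes the recurrence contracting. *)
Definition green_step g z y (k : int) : X :=
  let v := L (y (k - 1)) + g (k - 1) (y (k - 1)) + kick z (k - 1) in
  v - Pu v + J (y (k + 1) - (g k (y k) + kick z k)).

(** Applying [Pu] to a fixed point separates the unstable half of the recurrence,
    which [L] turns back into its forward form. *)
Lemma green_stepP g z y : green_step g z y = y <->
  forall k, y (k + 1) = L (y k) + g k (y k) + kick z k.
Proof.
split=> [fix_y k|rec].
  pose v j := L (y j) + g j (y j) + kick z j.
  have yE j : y j = v (j - 1) - Pu (v (j - 1)) +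
      J (y (j + 1) - (g j (y j) + kick z j)) by rewrite -{1}fix_y.
  have PuyE j : Pu (y j) = J (y (j + 1) - (g j (y j) + kick z j)).
    rewrite [in LHS]yE (linear_mapD linP) (linear_mapB linP) (hyp_PP hyp).
    by rewrite subrr add0r (hyp_PJ hyp).
  have us : L (Pu (y k)) = Pu (y (k + 1)) - Pu (g k (y k) + kick z k).
    by rewrite PuyE (hyp_LJ hyp) (linear_mapB linP).
  have := yE (k + 1); rewrite addrK -PuyE => ->.
  rewrite -/(v k) -[in RHS](subrK (Pu (v k)) (v k)); congr (_ + _).
  rewrite /v -addrA (linear_mapD linP) (hyp_PL hyp) us.
  by rewrite subrK.
apply/funext => k; rewrite /green_step -rec subrK.
by rewrite rec -(addrA (L (y k))) addrK (hyp_JL hyp) subrK.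
Qed.

Let Ps x := x - Pu x.

Let Ps_le v e b : v = L e + b -> `|Ps v| <= 16^-1 * `|e| + p * `|b|.
Proof.
move=> ->; rewrite /Ps (linear_mapD linP) opprD addrACA (hyp_PL hyp).
rewrite -(linear_mapB linL) (le_trans (ler_normD _ _))//.
by rewrite lerD// ?(hyp_Ls hyp)// (hyp_Ps hyp).
Qed.

Lemma green_step_sub g g' z z' y y' k :
  `|green_step g z y k - green_step g' z' y' k| <=
    16^-1 * `|y (k - 1) - y' (k - 1)|
  + p * `|g (k - 1) (y (k - 1)) + kick z (k - 1)
          - (g' (k - 1) (y' (k - 1)) + kick z' (k - 1))|
  + 16^-1 * (`|y (k + 1) - y' (k + 1)|
           + `|g k (y k) + kick z k - (g' k (y' k) + kick z' k)|).
Proof.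
rewrite /green_step.
set v := L _ + _ + _; set v' := L _ + _ + _.
have -> (m m' : X) : v - Pu v + J m - (v' - Pu v' + J m') =
    Ps (v - v') + J (m - m').
  rewrite /Ps (linear_mapB linP) (linear_mapB linJ) !opprD !opprK.
  zmod_identity.
rewrite (le_trans (ler_normD _ _))// lerD//.
  by apply: Ps_le; rewrite (linear_mapB linL) /v /v'; zmod_identity.
rewrite (le_trans (hyp_Jle hyp _))// ler_pM2l//.
have -> (a a' b b' : X) : a - b - (a' - b') = a - a' - (b - b').
  by zmod_identity.
exact: ler_normB.
Qed.

(** The weight may double from one index to the next, since
    2 (1/16 + 1/32 + 1/16) + 1/512 is still less than 1/2. *)
Lemma green_step_halving g z W : small_lipschitz p g ->
  (forall k, W (k - 1) <= 2 * W k) -> (forall k, W (k + 1) <= 2 * W k) ->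
  (forall k, 0 <= W k) -> halving W (green_step g z).
Proof.
move=> [_ hg] Wm Wp W_ge0 y y' c hc k.
have W0 j : 0 <= c * W j := le_trans (normr_ge0 _) (hc j).
have scale j : W j <= 2 * W k -> c * W j <= 2 * (c * W k).
  have [c0|c0] := leP 0 c; first by move=> Wj; rewrite mulrCA ler_wpM2l.
  by rewrite (le_trans _ (mulr_ge0 _ (W0 k)))// nmulr_rle0.
have wm := scale _ (Wm k); have wp := scale _ (Wp k).
apply: le_trans (green_step_sub _ _ _ _ _ _ _) _.
have -> (a b d : X) : a + d - (b + d) = a - b by zmod_identity.
have -> (a b d : X) : a + d - (b + d) = a - b by zmod_identity.
have gk := le_trans (hg k (y k) (y' k)) (ler_wpM2l _ (hc k)).
have gm := le_trans (hg (k - 1) (y (k - 1)) (y' (k - 1))) (ler_wpM2l _ (hc (k - 1))).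
have e0 : 0 <= (32 * p)^-1 by rewrite invr_ge0 mulr_ge0// ltW.
have {}gm := ler_wpM2l (ltW p0) (gm e0); have {}gk := gk e0.
have h32 : (32 * p)^-1 <= 32^-1 by rewrite lef_pV2 ?posrE ?mulr_gt0// ler_peMr.
have {}gk := le_trans gk (ler_wpM2r (W0 k) h32).
have pE : p * ((32 * p)^-1 * (c * W (k - 1))) = 32^-1 * (c * W (k - 1)).
  by field; rewrite gt_eqF.
rewrite pE in gm.
have hcm := hc (k - 1); have hcp := hc (k + 1); have Wk := W0 k.
rewrite mulrAC; lra.
Qed.

Definition decay (k : int) : R := 2^-1 ^+ `|k|%N.

Lemma decay_ge0 k : 0 <= decay k.
Proof. by rewrite exprn_ge0. Qed.

Lemma decay_le1 k : decay k <= 1.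
Proof. by rewrite exprn_ile1// invf_le1 ?ler1n. Qed.

Let decay_step (k l : int) : (`|k| <= `|l|.+1)%N -> decay l <= 2 * decay k.
Proof.
move=> kl; have -> : decay l = 2 * 2^-1 ^+ `|l|.+1.
  by rewrite exprS mulrA divff ?mul1r.
by rewrite ler_pM2l// ler_wiXn2l// ?invf_le1// ler1n.
Qed.

Let kicked_orbit_exists_decay g z : small_lipschitz p g ->
  exists y, kicked_orbit L g z y /\ forall k, `|y k| <= 2 * (p * `|z|) * decay k.
Proof.
move=> hg.
have hW k : 0 <= decay k <= 1 by rewrite decay_ge0 decay_le1.
have hG : halving decay (green_step g z).
  by apply: green_step_halving => // k; [| |exact: decay_ge0];
     apply: decay_step; lia.
have z0 : 0 <= p * `|z| by rewrite mulr_ge0// ltW.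
have [k|y [fy yle]] := halving_fixpoint hW hG (c := p * `|z|).
  rewrite /green_step !hg.1 (linear_map0 linL) !add0r /kick.
  have [->|k0] := eqVneq k 0.
    rewrite sub0r eqxx (_ : (0 == - 1 :> int) = false)// oppr0.
    by rewrite (linear_map0 linJ) addr0 /decay expr0 mulr1 (hyp_Ps hyp).
  rewrite (_ : (k - 1 == - 1) = false); last by apply/eqP; move: k0 => /eqP; lia.
  rewrite /= (linear_map0 linP) subrr add0r.
  have [->|km1] := eqVneq k (- 1); last first.
    by rewrite oppr0 (linear_map0 linJ) normr0 mulr_ge0// decay_ge0.
  rewrite (linear_mapN linJ) normrN /decay (_ : `|- 1 : int|%N = 1%N)// expr1.
  rewrite (le_trans (hyp_Jle hyp _))//.
  have : `|z| <= p * `|z| by rewrite ler_peMl.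
  lra.
exists y; split => //; split; last exact/green_stepP.
exists (2 * (p * `|z|)) => k; rewrite (le_trans (yle k))// ler_piMr ?decay_le1//.
by rewrite mulr_ge0.
Qed.

Lemma kicked_orbit_exists g z : small_lipschitz p g ->
  exists y, kicked_orbit L g z y.
Proof. by move=> /kicked_orbit_exists_decay -/(_ z)[y []]; exists y. Qed.

(** The perturbations are compared along the orbit [y'] only: in the applications
    it is an orbit of the limit problem, for which bounds are known. *)
Lemma kicked_orbit_stable g g' z z' y y' dlt : small_lipschitz p g ->
  kicked_orbit L g z y -> kicked_orbit L g' z' y' ->
  (forall k, `|g k (y' k) - g' k (y' k)| <= dlt) -> `|z - z'| <= dlt ->
  forall k, `|y k - y' k| <= 8 * p * dlt.
Proof.
move=> hg [[c hc] ry] [[c' hc'] ry'] hd hz.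
move/green_stepP in ry; move/green_stepP in ry'.
have d0 : 0 <= dlt by exact: le_trans (normr_ge0 _) hz.
have hk k : `|g k (y' k) + kick z k - (g' k (y' k) + kick z' k)| <= 2 * dlt.
  have -> (a b a' b' : X) : a + b - (a' + b') = a - a' + (b - b').
    by zmod_identity.
  rewrite (le_trans (ler_normD _ _))// mulr2n mulrDl mul1r lerD//.
  by rewrite /kick; case: eqP => _ //; rewrite subrr normr0.
have -> : 8 * p * dlt = 2 * (4 * p * dlt) by ring.
have hG : halving (fun=> 1) (green_step g z).
  by apply: green_step_halving => // k; rewrite mulr1 ler1n.
apply: (halving_stable (c := c + c') hG ry ry').
  by move=> k; rewrite (le_trans (ler_normB _ _))// lerD.
move=> k; apply: le_trans (green_step_sub _ _ _ _ _ _ _) _.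
rewrite !subrr !normr0 mulr0 !add0r.
have h1 := hk k; have h2 := ler_wpM2l (ltW p0) (hk (k - 1)).
have h3 : dlt <= p * dlt by rewrite ler_peMl.
lra.
Qed.

Lemma kicked_orbit_unique g z y y' : small_lipschitz p g ->
  kicked_orbit L g z y -> kicked_orbit L g z y' -> y = y'.
Proof.
move=> hg hy hy'; apply/funext => k; apply/eqP.
rewrite -subr_eq0 -normr_le0.
have := kicked_orbit_stable hg hy hy' (dlt := 0) _ _ k; rewrite mulr0; apply.
  by move=> j; rewrite subrr normr0.
by rewrite subrr normr0.
Qed.

Lemma kicked_orbit_decay g z y : small_lipschitz p g ->
  kicked_orbit L g z y -> forall k, `|y k| <= 2 * p * `|z| * decay k.
Proof.
move=> hg hy; have [y' [hy' yle]] := kicked_orbit_exists_decay z hg.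
by rewrite (kicked_orbit_unique hg hy hy') -mulrA in yle *.
Qed.

End hyperbolic.

(** * Bounded linear maps *)

Section bounded_linear.
Context {R : realType} {X : normedModType R}.
Implicit Types (f : X -> X) (c : R).

Lemma bounded_linear_of_bound f c : linear f -> (forall x, `|f x| <= c * `|x|) ->
  bounded_linear f.
Proof.
move=> lf fc; split=> // x; apply/cvgrPdist_lt => e e0.
have c0 : 0 < `|c| + 1 by rewrite ltr_wpDl.
have : `|x - t| @[t --> x] --> `|x - x|.
  by apply: cvg_norm; apply: cvgB; [exact: cvg_cst|exact: cvg_id].
rewrite subrr normr0 => /cvgr0_norm_lt /(_ (e / (`|c| + 1))).
move=> /(_ (divr_gt0 e0 c0)); apply: filterS => t; rewrite normr_id => xt.
rewrite -(linear_mapB lf) (le_lt_trans (fc _))//.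
rewrite ltr_pdivlMr// mulrC in xt; apply: le_lt_trans xt.
by rewrite ler_wpM2r// (le_trans (ler_norm _))// lerDl.
Qed.

Lemma bounded_linear_bound f : bounded_linear f ->
  exists2 c, 0 <= c & forall x, `|f x| <= c * `|x|.
Proof.
move=> [lf cf].
have : f t @[t --> (0 : X)] --> f 0 by exact: cf.
rewrite (linear_map0 lf) => /cvgr0_norm_lt /(_ _ ltr01) /nbhs_ballP[e /= e0 he].
exists (2 / e) => [|x]; first by rewrite divr_ge0// ltW.
have [->|x0] := eqVneq x 0; first by rewrite (linear_map0 lf) !normr0 mulr0.
have nx : 0 < `|x| by rewrite normr_gt0.
pose a := e / 2 / `|x|.
have a0 : 0 < a by rewrite /a !divr_gt0.
have : `|f (a *: x)| < 1.
  apply: he; rewrite -ball_normE /= sub0r normrN normrZ gtr0_norm// /a divfK ?gt_eqF//.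
  by rewrite ltr_pdivrMr// ltr_pMr// ltr1n.
rewrite (linear_mapZ lf) normrZ gtr0_norm// -ltr_pdivlMl// mulr1 => /ltW/le_trans; apply.
by rewrite /a !invf_div mulrC.
Qed.

Lemma opnorm_le f c : 0 <= c -> (forall x, `|f x| <= c * `|x|) ->
  (opnorm f <= c%:E)%E.
Proof.
move=> c0 fc; apply: ge_ereal_sup => _ [x /= x1 <-].
by rewrite lee_fin (le_trans (fc x))// ler_piMr.
Qed.

Lemma le_opnorm f c : linear f -> (opnorm f <= c%:E)%E ->
  forall x, `|f x| <= c * `|x|.
Proof.
move=> lf fc x.
have [->|x0] := eqVneq x 0; first by rewrite (linear_map0 lf) !normr0 mulr0.
have nx : 0 < `|x| by rewrite normr_gt0.
have : (`|f (`|x|^-1 *: x)|%:E <= c%:E)%E.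
  apply: le_trans fc; apply: ereal_sup_ubound; exists (`|x|^-1 *: x) => //=.
  by rewrite normrZ gtr0_norm ?invr_gt0// mulVf// gt_eqF.
rewrite lee_fin (linear_mapZ lf) normrZ gtr0_norm ?invr_gt0//.
by rewrite ler_pdivrMl// mulrC.
Qed.

Lemma opnorm_ge0 f : (0 <= opnorm f)%E.
Proof.
apply: le_trans (ereal_sup_ubound _); last first.
  by exists 0 => //=; rewrite normr0.
by rewrite lee_fin.
Qed.

End bounded_linear.

(** * Roughness of exponential dichotomies *)

Section process.
Context {R : realType} {X : completeNormedModType R}.
Implicit Types (S : R -> R -> X -> X) (x z : X) (s t : R).

Definition evolution S :=
  (forall t x, S t t x = x) /\
  forall r s t x, r <= s -> s <= t -> S t s (S s r x) = S t r x.

Definition grid (tau t : R) (k : int) : R := t + k%:~R * tau.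

(** Over one time step [tau], the process is close to one and the same map [L],
    wherever the step begins. *)
Definition near_map (L : X -> X) (p tau K : R) S :=
  [/\ evolution S,
      forall s t, s <= t -> linear (S t s),
      forall s t x, s <= t -> t <= s + tau -> `|S t s x| <= K * `|x|
    & forall s x, `|S (s + tau) s x - L x| <= (32 * p)^-1 * `|x|].

Definition deviation (L : X -> X) tau S t (k : int) (x : X) : X :=
  S (grid tau t (k + 1)) (grid tau t k) x - L x.

(** The unique bounded orbit of the process that jumps by [x] at time [t]: it
    lies in the stable space from [t] on and in the unstable one before. *)
Definition split_orbit (L : X -> X) tau S t x : int -> X :=
  get (kicked_orbit L (deviation L tau S t) x).

Definition unstable_proj (L : X -> X) tau S t x : X :=
  x - split_orbit L tau S t x 0.

Variables (L Pu J : X -> X) (p tau K : R).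
Hypothesis hyp : hyperbolic_map L Pu J p.
Hypothesis tau0 : 0 < tau.
Hypothesis K1 : 1 <= K.

Notation gd := (grid tau).
Notation dev := (deviation L tau).
Notation orb := (split_orbit L tau).
Notation proj := (unstable_proj L tau).

Let p1 : 1 <= p. Proof. exact: hyp_p1 hyp. Qed.
Let p0 : 0 < p. Proof. exact: lt_le_trans p1. Qed.
Let K0 : 0 <= K. Proof. exact: le_trans K1. Qed.

Lemma grid0 t : gd t 0 = t. Proof. by rewrite /grid mul0r addr0. Qed.

Lemma gridS t k : gd t (k + 1) = gd t k + tau.
Proof. by rewrite /grid rmorphD/= mulrDl mul1r addrA. Qed.

Lemma gridD t j k : gd (gd t j) k = gd t (j + k).
Proof. by rewrite /grid rmorphD/= mulrDl addrA. Qed.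

Lemma grid_le t j k : (j <= k)%R -> gd t j <= gd t k.
Proof. by move=> jk; rewrite lerD2l ler_wpM2r ?ler_int// ltW. Qed.

Lemma grid_mono s t k : s <= t -> gd s k <= gd t k.
Proof. by rewrite lerD2r. Qed.

(** Both ends of the translation between integer steps and real times: [n] whole
    steps fit before [t], and 2^-n decays at the exponential rate [ln 2 / tau]. *)
Lemma grid_exists s t : s <= t -> exists n : nat,
  [/\ gd s n <= t, t <= gd s n + tau &
      2^-1 ^+ n <= 2 * expR (- (ln 2 / tau) * (t - s))].
Proof.
move=> st; pose a := (t - s) / tau.
have a0 : 0 <= a by rewrite divr_ge0 ?subr_ge0// ltW.
have /andP[h1 h2] := truncn_itv a0.
have tE : t = s + a * tau by rewrite /a divfK ?gt_eqF// addrC subrK.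
exists (Num.truncn a); split.
- by rewrite [leRHS]tE lerD2l ler_pM2r.
- by rewrite -gridS [leLHS]tE lerD2l ler_pM2r// ltW// -PoszD addn1.
have -> : - (ln 2 / tau) * (t - s) = - (ln 2 * a).
  by rewrite /a; field; rewrite gt_eqF.
have -> : 2^-1 ^+ Num.truncn a = 2 * 2^-1 ^+ (Num.truncn a).+1 :> R.
  by rewrite exprS mulrA divff ?mul1r.
rewrite ler_pM2l// exprVn -(@lnK _ (2 ^+ (Num.truncn a).+1)) ?posrE ?exprn_gt0//.
rewrite -expRN ler_expR lerN2 lnXn// -[leRHS]mulr_natr ler_wpM2l ?ltW//.
by rewrite ln_gt0// ltr1n.
Qed.

Variable S : R -> R -> X -> X.
Hypothesis hS : near_map L p tau K S.

Let Sid t x : S t t x = x. Proof. by case: hS => -[]. Qed.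
Let Scomp r s t x : r <= s -> s <= t -> S t s (S s r x) = S t r x.
Proof. by case: hS => -[_ h] *; exact: h. Qed.
Let linS s t : s <= t -> linear (S t s). Proof. by case: hS => _ h *; exact: h. Qed.
Let Sle s t x : s <= t -> t <= s + tau -> `|S t s x| <= K * `|x|.
Proof. by case: hS => _ _ h *; exact: h. Qed.

Let gle t k : gd t k <= gd t (k + 1).
Proof. by apply: grid_le; rewrite lerDl. Qed.

Lemma deviation_small t : small_lipschitz p (dev S t).
Proof.
split=> [k|k x x']; rewrite /deviation.
  by rewrite (linear_map0 (linS (gle _ _))) (linear_map0 (hyp_linL hyp)) subrr.
have -> (a a' b b' : X) : a - b - (a' - b') = (a - a') - (b - b').
  by zmod_identity.
rewrite -(linear_mapB (linS (gle _ _))) -(linear_mapB (hyp_linL hyp)) gridS.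
by case: hS.
Qed.

Lemma kicked_orbit_process t x (y : int -> X) :
  kicked_orbit L (dev S t) x y <-> (exists c, forall k, `|y k| <= c) /\
    forall k, y (k + 1) = S (gd t (k + 1)) (gd t k) (y k) + kick x k.
Proof.
split=> -[hc rec]; split=> // k; rewrite rec /deviation; zmod_identity.
Qed.

Lemma split_orbitP t x : kicked_orbit L (dev S t) x (orb S t x).
Proof.
apply: getPex; have [y hy] := kicked_orbit_exists hyp x (deviation_small t).
by exists y.
Qed.

Lemma split_orbitE t x y : kicked_orbit L (dev S t) x y ->
  orb S t x = y.
Proof.
move=> hy.
exact: (kicked_orbit_unique hyp (deviation_small t) (split_orbitP t x) hy).
Qed.

Lemma split_orbit_le t x k : `|orb S t x k| <= 2 * p * `|x| * decay k.
Proof.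
exact: (kicked_orbit_decay hyp (deviation_small t) (split_orbitP t x) k).
Qed.

Lemma split_orbit_linear t k : linear (fun x => orb S t x k).
Proof.
move=> a u v; rewrite (@split_orbitE _ _
  (fun k => a *: orb S t u k + orb S t v k))//.
have /kicked_orbit_process[[c hc] ru] := split_orbitP t u.
have /kicked_orbit_process[[c' hc'] rv] := split_orbitP t v.
apply/kicked_orbit_process; split.
  exists (`|a| * c + c') => j; rewrite (le_trans (ler_normD _ _))// lerD//.
  by rewrite normrZ ler_wpM2l.
move=> j; rewrite ru rv (linear_mapD (linS (gle _ _))).
rewrite (linear_mapZ (linS (gle _ _))) /kick.
by case: eqP => _; rewrite scalerDr ?addr0 ?scaler0 ?addr0// addrACA.
Qed.

Lemma split_orbit_forward t x (n : nat) :
  orb S t x n = S (gd t n) t (orb S t x 0).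
Proof.
have /kicked_orbit_process[_ r] := split_orbitP t x.
elim: n => [|n ih]; first by rewrite grid0 Sid.
have -> : n.+1%:Z = n%:Z + 1 by rewrite -PoszD addn1.
rewrite r ih Scomp//; last by rewrite -[leLHS]grid0 grid_le.
by rewrite /kick (_ : (n%:Z == - 1) = false)// addr0.
Qed.

(** The forward orbit of [x], preceded by zeros, is a bounded orbit kicked by [x];
    by uniqueness it is the split orbit. *)
Lemma forward_bounded_split t x c : (forall n : nat, `|S (gd t n) t x| <= c) ->
  orb S t x 0 = x.
Proof.
move=> hc; pose y (k : int) := if 0 <= k then S (gd t k) t x else 0.
rewrite (@split_orbitE _ _ y) /y ?lexx ?grid0 ?Sid//.
apply/kicked_orbit_process; split.
  exists c => -[n|n]/=; first exact: hc.
  by rewrite normr0 (le_trans _ (hc 0%N)).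
move=> k; have [k0|k0] := leP 0 k.
  rewrite (_ : 0 <= k + 1); last by lia.
  rewrite Scomp//; last by rewrite -[leLHS]grid0 grid_le.
  by rewrite /kick (_ : (k == - 1) = false) ?addr0//; apply/eqP; lia.
rewrite (linear_map0 (linS (gle _ _))) add0r /kick.
have [->|k1] := eqVneq k (- 1); first by rewrite addNr lexx grid0 Sid.
by rewrite (_ : (0 <= k + 1) = false)//; apply/negP; move: k1 => /eqP; lia.
Qed.

(** [z n] is the position at time [gd t (- n)]. *)
Definition backward_orbit t (z : nat -> X) :=
  forall n, S (gd t (- n%:Z)) (gd t (- n.+1%:Z)) (z n.+1) = z n.

(** The opposite of a bounded backward orbit, followed by zeros, is kicked by the
    endpoint of that orbit. *)
Lemma backward_bounded_split t (z : nat -> X) c : backward_orbit t z ->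
  (forall n, `|z n| <= c) -> orb S t (z 0%N) 0 = 0.
Proof.
move=> hz hc; pose y (k : int) := if 0 <= k then 0 else - z `|k|%N.
rewrite (@split_orbitE _ _ y) /y ?lexx//.
apply/kicked_orbit_process; split.
  exists c => k; case: ifP => _; last by rewrite normrN.
  by rewrite normr0 (le_trans _ (hc 0%N)).
move=> k; have [k0|k0] := leP 0 k.
  rewrite (_ : 0 <= k + 1); last by lia.
  rewrite (linear_map0 (linS (gle _ _))) add0r.
  by rewrite /kick (_ : (k == - 1) = false)//; apply/eqP; lia.
rewrite (linear_mapN (linS (gle _ _))).
have [n kE] : exists n, k = - n.+1%:Z by exists `|k|%N.-1; lia.
have k1E : k + 1 = - n%:Z by lia.
have -> : `|k|%N = n.+1 by lia.
rewrite k1E kE hz /kick; case: n kE k1E => [|n] kE k1E.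
  by rewrite eqxx addNr.
rewrite (_ : (0 <= - n.+1%:Z :> int) = false); last by lia.
rewrite (_ : (- n.+2%:Z == - 1) = false); last by apply/eqP; lia.
by rewrite addr0; congr (- z _); lia.
Qed.

Lemma unstable_proj_backward t x : exists z : nat -> X, [/\ backward_orbit t z,
  z 0%N = proj S t x &
  forall n, `|z n.+1| <= 2 * p * `|x| * 2^-1 ^+ n.+1].
Proof.
have /kicked_orbit_process[_ r] := split_orbitP t x.
exists (fun n => if n is 0 then proj S t x
                 else - orb S t x (- n%:Z)); split=> //; last first.
  by move=> n; rewrite normrN (le_trans (split_orbit_le _ _ _)).
move=> n.
have le_n : gd t (- n.+1%:Z) <= gd t (- n%:Z) by apply: grid_le; lia.
rewrite (linear_mapN (linS le_n)).
have kE : - n.+1%:Z + 1 = - n%:Z by lia.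
have := r (- n.+1%:Z); rewrite kE => /esym rn.
have {rn} -> : S (gd t (- n%:Z)) (gd t (- n.+1%:Z))
    (orb S t x (- n.+1%:Z)) = orb S t x (- n%:Z) - kick x (- n.+1%:Z).
  by rewrite -rn addrK.
rewrite /kick; case: n {kE le_n} => [|n].
  by rewrite eqxx oppr0 opprB.
by rewrite (_ : (- n.+2%:Z == - 1) = false) ?subr0//; apply/eqP; lia.
Qed.

Lemma process_bounded n s t x : s <= t -> t <= s + n%:R * tau ->
  `|S t s x| <= K ^+ n * `|x|.
Proof.
elim: n t => [|n ih] t st ts.
  have -> : t = s by apply/eqP; rewrite eq_le st andbT -[s]addr0 -(mul0r tau).
  by rewrite Sid expr0 mul1r.
have Kn : K ^+ n <= K ^+ n.+1 by rewrite ler_weXn2l.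
have [h|h] := leP t (s + n%:R * tau).
  by rewrite (le_trans (ih _ st h))// ler_wpM2r.
have su : s <= s + n%:R * tau by rewrite lerDl mulr_ge0// ltW.
rewrite -(Scomp _ su (ltW h)) exprS -mulrA.
apply: (le_trans (Sle _ (ltW h) _)).
  by rewrite (le_trans ts)// -addrA lerD2l mulrSr mulrDl mul1r.
by rewrite ler_wpM2l// ih.
Qed.

(** The process carries a split orbit on the grid of [s] to a bounded kicked orbit
    on the grid of [t].  Uniqueness thus gives invariance of the projections
    under the process for all real times, not only for multiples of [tau]. *)
Lemma split_orbit_commute s t x : s <= t ->
  orb S t (S t s x) 0 = S t s (orb S s x 0).
Proof.
move=> st.
have gst k : gd s k <= gd t k by exact: grid_mono.
have /kicked_orbit_process[[c hc] r] :=
  split_orbitP s x.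
pose y k := S (gd t k) (gd s k) (orb S s x k).
rewrite (split_orbitE (y := y)) /y ?grid0//.
apply/kicked_orbit_process; split.
  have [n [_ tn _]] := grid_exists st.
  exists (K ^+ n.+1 * c) => k.
  have c0 : 0 <= c by exact: le_trans (normr_ge0 _) (hc k).
  apply: (le_trans (@process_bounded n.+1 _ _ _ (gst k) _)).
    by rewrite addrAC lerD2r mulrSr mulrDl mul1r addrA.
  by rewrite ler_wpM2l// exprn_ge0.
move=> k; rewrite r (linear_mapD (linS (gst _))); congr (_ + _).
  by rewrite !Scomp.
rewrite /kick; case: eqP => [->|_]; last by rewrite (linear_map0 (linS (gst _))).
by rewrite addNr !grid0.
Qed.

Lemma split_orbit_idem t x : orb S t (orb S t x 0) 0 = orb S t x 0.
Proof.
apply: (forward_bounded_split (c := 2 * p * `|x|)) => n.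
rewrite -split_orbit_forward.
rewrite (le_trans (split_orbit_le _ _ _))// ler_piMr ?decay_le1//.
by rewrite !mulr_ge0// ltW.
Qed.

Lemma split_orbit_unstable_proj t x : orb S t (proj S t x) 0 = 0.
Proof.
rewrite /unstable_proj (linear_mapB (split_orbit_linear t 0)).
by rewrite split_orbit_idem subrr.
Qed.

Lemma unstable_projP t x : range (proj S t) x <-> orb S t x 0 = 0.
Proof.
split=> [[u _ <-]|o0]; first exact: split_orbit_unstable_proj.
by exists x => //; rewrite /unstable_proj o0 subr0.
Qed.

Lemma unstable_proj_linear t : linear (proj S t).
Proof.
move=> a u v; rewrite /unstable_proj (split_orbit_linear t 0).
by rewrite scalerBr; zmod_identity.
Qed.

Lemma unstable_proj_le t x : `|proj S t x| <= (1 + 2 * p) * `|x|.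
Proof.
rewrite /unstable_proj mulrDl mul1r (le_trans (ler_normB _ _))// lerD2l.
by rewrite (le_trans (split_orbit_le _ _ _))// /decay expr0 mulr1.
Qed.

(** Every unstable vector at time [t] is reached from the range at an earlier
    time: follow its backward orbit past [s], then come forward again. *)
Lemma unstable_proj_back s t x : s <= t -> exists w, [/\ orb S s w 0 = 0,
  S t s w = proj S t x &
  `|w| <= 4 * p * K * expR (- (ln 2 / tau) * (t - s)) * `|x|].
Proof.
move=> st; have [n [sn tn en]] := grid_exists st.
have [z [hz z0 zle]] := unstable_proj_backward t x.
set u := gd t (- n.+1%:Z).
have us : u <= s.
  have -> : u = t - gd s n - tau + s by rewrite /u /grid -addn1 PoszD rmorphN rmorphD/=; ring.
  by rewrite gerDr subr_le0 lerBlDl.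
have su : s <= u + tau.
  have -> : u + tau = s + (t - gd s n) by rewrite /u /grid -addn1 PoszD rmorphN rmorphD/=; ring.
  by rewrite lerDl subr_ge0.
have zS (m : nat) : S t (gd t (- m%:Z)) (z m) = z 0%N.
  elim: m => [|m ih]; first by rewrite oppr0 grid0 Sid.
  rewrite -ih -(hz m) Scomp//.
    by apply: grid_le => //; rewrite lerN2 lez_nat.
  by rewrite -[leRHS]grid0; apply: grid_le => //; rewrite oppr_le0.
exists (S s u (z n.+1)); split.
- rewrite (split_orbit_commute _ us).
  have -> : orb S u (z n.+1) 0 = 0.
    apply: (backward_bounded_split (z := fun m => z (m + n.+1)%N)
      (c := 2 * p * `|x|)) => [m|m].
      by rewrite /u !gridD -!opprD -!PoszD !(addnC n.+1); exact: hz.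
    rewrite addnS (le_trans (zle _))// ler_piMr//; first by rewrite !mulr_ge0// ltW.
    by rewrite exprn_ile1// invf_le1 ?ler1n.
  by rewrite (linear_map0 (linS us)).
- by rewrite Scomp// zS.
rewrite (le_trans (Sle _ us su))//.
have h := ler_wpM2l K0 (zle n); apply: (le_trans h).
have -> : K * (2 * p * `|x| * 2^-1 ^+ n.+1) = K * p * `|x| * 2^-1 ^+ n.
  by rewrite exprS; field.
have q0 : 0 <= K * p * `|x| by rewrite !mulr_ge0// ltW.
apply: (le_trans (ler_wpM2l q0 en)).
rewrite (_ : 4 * p * K * _ * _ =
  2 * (K * p * `|x| * (2 * expR (- (ln 2 / tau) * (t - s))))); last by ring.
by rewrite ler_peMl ?ler1n// mulr_ge0// mulr_ge0// expR_ge0.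
Qed.

(** Injectivity on the unstable ranges: a vector that the process kills has a
    bounded forward orbit, hence no unstable part. *)
Theorem near_map_dichotomy : exp_dichotomy S (proj S).
Proof.
split=> [t|].
  split=> [|x]; last by rewrite {1}/unstable_proj split_orbit_unstable_proj subr0.
  exact: bounded_linear_of_bound (unstable_proj_linear t) (unstable_proj_le t).
exists (4 * p * K), (ln 2 / tau); split.
- have : 1 <= p * K by rewrite mulr_ege1.
  by rewrite -mulrA => h; rewrite (le_trans h)// ler_peMl ?ler1n// (le_trans _ h).
- by rewrite divr_gt0// ln_gt0// ltr1n.
move=> s t st.
have inj : {in range (proj S s) &, injective (S t s)}.
  move=> u v /set_mem/unstable_projP u0 /set_mem/unstable_projP v0 uv.
  apply/eqP; rewrite -subr_eq0; apply/eqP.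
  have h0 : orb S s (u - v) 0 = 0.
    by rewrite (linear_mapB (split_orbit_linear s 0)) u0 v0 subr0.
  have S0 : S t s (u - v) = 0 by rewrite (linear_mapB (linS st)) uv subrr.
  have [n [sn tn _]] := grid_exists st.
  rewrite -{}h0; apply/esym.
  apply: (forward_bounded_split (c := K ^+ n.+1 * `|u - v|)) => m.
  have sm : s <= gd s m by rewrite -[leLHS]grid0; apply: grid_le.
  have [tm|mt] := leP t (gd s m).
    rewrite -(Scomp _ st tm) S0 (linear_map0 (linS tm)) normr0.
    by rewrite mulr_ge0// exprn_ge0.
  apply: process_bounded => //; rewrite (le_trans (ltW mt))// (le_trans tn)//.
  by rewrite /grid -addrA lerD2l mulrSr mulrDl mul1r.
split.
- by move=> x; rewrite /unstable_proj !subKr split_orbit_commute.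
- split=> //.
    move=> _ [u _ <-]; apply/unstable_projP.
    by rewrite split_orbit_commute// split_orbit_unstable_proj (linear_map0 (linS st)).
  move=> _ [u _ <-]; have [w [w0 wS _]] := unstable_proj_back u st.
  by exists w => //; apply/unstable_projP.
- apply: opnorm_le => [|x].
    by rewrite !mulr_ge0// ?expR_ge0// ltW.
  have [n [sn tn en]] := grid_exists st.
  have s_n : s <= gd s n by rewrite -[leLHS]grid0; apply: grid_le.
  rewrite /unstable_proj subKr -(Scomp _ s_n sn).
  rewrite -split_orbit_forward (le_trans (Sle _ sn tn))//.
  have h := split_orbit_le s x n.
  rewrite (le_trans (ler_wpM2l K0 h))//.
  have q0 : 0 <= K * (2 * p * `|x|) by rewrite !mulr_ge0// ltW.
  have := ler_wpM2l q0 en; rewrite /decay /= -!mulrA => /le_trans; apply.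
  by apply: le_of_eq; ring.
apply: opnorm_le => [|x].
  by rewrite !mulr_ge0// ?expR_ge0// ltW.
have [w [w0 wS wle]] := unstable_proj_back x st.
rewrite /= -wS pinvKV//; last by rewrite inE; apply/unstable_projP.
by rewrite -(opprB t s) mulrN -mulNr.
Qed.

End process.

(** * Local unstable sets as graphs *)

Section radial.
Context {R : realType} {X : normedModType R}.
Implicit Types (r : R) (x y : X).

Definition radial r x : X := if `|x| <= r then x else (r / `|x|) *: x.

Lemma radial_id r x : `|x| <= r -> radial r x = x.
Proof. by rewrite /radial => ->. Qed.

Lemma radial_le r x : 0 <= r -> `|radial r x| <= r.
Proof.
rewrite /radial => r0; case: (leP `|x| r) => // rx.
have x0 : 0 < `|x| by exact: le_lt_trans rx.
by rewrite normrZ ger0_norm ?divr_ge0// divfK ?gt_eqF.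
Qed.

Lemma radial_lipschitz r x y : 0 <= r ->
  `|radial r x - radial r y| <= 2 * `|x - y|.
Proof.
move=> r0; have dxy := lerB_dist x y; have dyx := lerB_dist y x.
rewrite (distrC y x) in dyx.
have out (a b : X) : `|a| <= r -> r < `|b| ->
    `|a - (r / `|b|) *: b| <= `|a - b| + (`|b| - `|a|).
  move=> ar rb; have b0 : 0 < `|b| by exact: le_lt_trans rb.
  rewrite (le_trans (ler_distD b _ _))// lerD2l -{1}[b]scale1r -scalerBl normrZ.
  have rb1 : r / `|b| <= 1 by rewrite ler_pdivrMr// mul1r ltW.
  rewrite ger0_norm ?subr_ge0// mulrBl mul1r divfK ?gt_eqF//.
  by rewrite lerD2l lerN2.
rewrite /radial; case: (leP `|x| r) => rx; case: (leP `|y| r) => ry.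
- by rewrite ler_peMl// ler1n.
- by have := out x y rx ry; lra.
- rewrite distrC; have := out y x ry rx; rewrite (distrC y x); lra.
have x0 : 0 < `|x| by exact: le_lt_trans rx.
have y0 : 0 < `|y| by exact: le_lt_trans ry.
have -> : (r / `|x|) *: x - (r / `|y|) *: y =
    (r / `|x|) *: (x - y) + (r / `|x| - r / `|y|) *: y.
  by rewrite scalerBr scalerBl; zmod_identity.
rewrite (le_trans (ler_normD _ _))// (normrZ (r / `|x|)).
rewrite (normrZ (r / `|x| - r / `|y|)).
have rx1 : r / `|x| <= 1 by rewrite ler_pdivrMr// mul1r ltW.
have rx0 : 0 <= r / `|x| by rewrite divr_ge0.
have -> : `|r / `|x| - r / `|y| | * `|y| = (r / `|x|) * `| `|y| - `|x| |.
  rewrite -[X in _ * X = _](gtr0_norm y0) -normrM -[in RHS](ger0_norm rx0) -normrM.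
  by congr `|_|; field; rewrite !gt_eqF.
rewrite (ger0_norm rx0) -mulrDr (le_trans (ler_piMl _ rx1)) ?addr_ge0//.
rewrite mulr2n mulrDl mul1r lerD2l (le_trans (ler_dist_dist _ _))//.
by rewrite distrC.
Qed.

End radial.

Section unstable_graph.
Context {R : realType} {X : completeNormedModType R}.
Implicit Types (S N : R -> R -> X -> X) (x z : X) (s t : R).

(** The constant is half of the one for linear processes, as the radial
    retraction used to extend the maps beyond the ball is 2-Lipschitz. *)
Definition near_map_on_ball (L : X -> X) (p tau K r : R) N :=
  [/\ evolution N,
      forall s t, s <= t -> N t s 0 = 0,
      forall s t x, s <= t -> t <= s + tau -> `|x| <= r ->
        `|N t s x| <= K * `|x|
    & forall s x x', `|x| <= r -> `|x'| <= r ->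
        `|N (s + tau) s x - N (s + tau) s x' - L (x - x')| <=
          (64 * p)^-1 * `|x - x'|].

(** Nonlinear with a cut-off before time [t], linear afterwards: a bounded orbit
    then ends, after time [t], in the linear stable space. *)
Definition glued_deviation (L : X -> X) (tau r : R) S N t (k : int) (x : X) : X :=
  if k < 0 then N (grid tau t (k + 1)) (grid tau t k) (radial r x) - L (radial r x)
  else deviation L tau S t k x.

Definition glued_orbit (L : X -> X) (tau r : R) S N t z : int -> X :=
  get (kicked_orbit L (glued_deviation L tau r S N t)
    (- unstable_proj L tau S t z)).

(** The impulse removes exactly the unstable part of the incoming position, so
    the position after the impulse is its stable part. *)
Definition unstable_graph (L : X -> X) (tau r : R) S N t z : X :=
  glued_orbit L tau r S N t z 0.

Variables (L Pu J : X -> X) (p tau K r : R).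
Hypothesis hyp : hyperbolic_map L Pu J p.
Hypothesis tau0 : 0 < tau.
Hypothesis K1 : 1 <= K.
Hypothesis r0 : 0 < r.

Notation gd := (grid tau).
Notation orb := (split_orbit L tau).
Notation proj := (unstable_proj L tau).

Let p1 : 1 <= p. Proof. exact: hyp_p1 hyp. Qed.
Let p0 : 0 < p. Proof. exact: lt_le_trans p1. Qed.
Let K0 : 0 <= K. Proof. exact: le_trans K1. Qed.

Section graph.
Variables (S N : R -> R -> X -> X).
Hypothesis hS : near_map L p tau K S.
Hypothesis hN : near_map_on_ball L p tau K r N.

Notation glued := (glued_deviation L tau r S N).
Notation Sigma := (unstable_graph L tau r S N).
Notation gorb := (glued_orbit L tau r S N).

Let Nid t x : N t t x = x. Proof. by case: hN => -[]. Qed.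
Let Ncomp u s t x : u <= s -> s <= t -> N t s (N s u x) = N t u x.
Proof. by case: hN => -[_ h] *; exact: h. Qed.
Let N0 s t : s <= t -> N t s 0 = 0. Proof. by case: hN => _ h *; exact: h. Qed.
Let Nle s t x : s <= t -> t <= s + tau -> `|x| <= r -> `|N t s x| <= K * `|x|.
Proof. by case: hN => _ _ h *; exact: h. Qed.

Let gle t k : gd t k <= gd t (k + 1).
Proof. by apply: grid_le => //; rewrite lerDl. Qed.

Lemma glued_small t : small_lipschitz p (glued t).
Proof.
have [d0 dlip] := deviation_small hyp tau0 hS t.
split=> [k|k x x']; rewrite /glued_deviation; case: ifP => // _.
  by rewrite radial_id ?normr0 1?ltW// N0// (linear_map0 (hyp_linL hyp)) subrr.
have -> (a a' b b' : X) : a - b - (a' - b') = a - a' - (b - b').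
  by zmod_identity.
rewrite -(linear_mapB (hyp_linL hyp)) gridS.
case: hN => _ _ _ /(_ (gd t k) _ _ (radial_le x (ltW r0)) (radial_le x' (ltW r0))) h.
rewrite (le_trans h)//.
have -> : (32 * p)^-1 = (64 * p)^-1 * 2 by field; rewrite gt_eqF.
rewrite -mulrA ler_wpM2l ?radial_lipschitz ?(ltW r0)//.
by rewrite invr_ge0 mulr_ge0// ltW.
Qed.

Lemma glued_orbitP t z : kicked_orbit L (glued t) (- proj S t z) (gorb t z).
Proof.
apply: getPex.
have [y hy] := kicked_orbit_exists hyp (- proj S t z) (glued_small t).
by exists y.
Qed.

Lemma glued_orbit_le t z k :
  `|gorb t z k| <= 2 * p * (1 + 2 * p) * `|z| * decay k.
Proof.
apply: (le_trans (kicked_orbit_decay hyp (glued_small t) (glued_orbitP t z) k)).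
rewrite ler_wpM2r ?decay_ge0// -[leRHS]mulrA ler_wpM2l ?mulr_ge0 ?(ltW p0)//.
by rewrite normrN (unstable_proj_le hyp tau0 hS).
Qed.

Lemma unstable_graph_proj t z : Sigma t (proj S t z) = Sigma t z.
Proof.
congr (get (kicked_orbit L _ (- _)) _).
have [/(_ t)[_ ->]//] := near_map_dichotomy hyp tau0 K1 hS.
Qed.

(** From time [t] on, the glued orbit is a bounded orbit of the linear process. *)
Lemma unstable_graph_stable t z : orb S t (Sigma t z) 0 = Sigma t z.
Proof.
have [[c hc] rec] := glued_orbitP t z.
apply: (forward_bounded_split hyp tau0 K1 hS (c := c)) => n.
suff -> : S (gd t n) t (Sigma t z) = gorb t z n by [].
elim: n => [|n ih].
  by rewrite grid0; case: hS => -[-> _].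
have -> : n.+1%:Z = n%:Z + 1 by rewrite -PoszD addn1.
case: (hS) => -[_ Sc] _ _ _.
rewrite -(Sc _ _ _ _ _ (gle t n)); last first.
  by rewrite -[leLHS](grid0 tau); apply: grid_le.
rewrite ih rec /kick (_ : (n%:Z == - 1) = false)// addr0.
by rewrite /glued_deviation /= /deviation; zmod_identity.
Qed.

Lemma unstable_graph_range t z :
  range (fun x => x - proj S t x) (Sigma t z).
Proof.
exists (Sigma t z) => //.
by rewrite /unstable_proj unstable_graph_stable subrr subr0.
Qed.

(** The position at time [u] is computed from any earlier time of the grid; the
    evolution property makes the choice irrelevant. *)
Lemma global_solution_of_backward_orbit t (z : nat -> X) : backward_orbit tau N t z ->
  exists zeta, [/\ global_solution N zeta, zeta t = z 0%N &
    forall n u, gd t (- n%:Z) <= u -> zeta u = N u (gd t (- n%:Z)) (z n)].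
Proof.
move=> hz.
have gN (m n : nat) : (m <= n)%N -> gd t (- n%:Z) <= gd t (- m%:Z).
  by move=> mn; apply: grid_le => //; lia.
have back (m n : nat) : (m <= n)%N ->
    N (gd t (- m%:Z)) (gd t (- n%:Z)) (z n) = z m.
  move=> /subnKC <-; elim: (n - m)%N => [|k ih]; first by rewrite addn0 Nid.
  rewrite addnS -[RHS]ih -(hz (m + k)%N) Ncomp//; apply: gN => //.
  by rewrite leq_addr.
have ex u : exists n : nat, gd t (- n%:Z) <= u.
  have [ut|/ltW tu] := leP u t; last by exists 0%N; rewrite oppr0 grid0.
  have [n [_ tn _]] := grid_exists tau0 ut.
  exists n.+1; move: tn; rewrite /grid -addn1 PoszD opprD rmorphB/= rmorphN/=; lra.
have [m hm] := choice ex.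
have indep u (i j : nat) : gd t (- i%:Z) <= u -> gd t (- j%:Z) <= u ->
    N u (gd t (- i%:Z)) (z i) = N u (gd t (- j%:Z)) (z j).
  wlog ij : i j / (i <= j)%N.
    by move=> h; case: (leqP i j) => [|/ltnW] ij *; [|symmetry]; exact: h.
  by move=> iu _; rewrite -(back _ _ ij) Ncomp// gN.
exists (fun u => N u (gd t (- (m u)%:Z)) (z (m u))); split.
- move=> s u su; rewrite Ncomp//; apply: indep => //.
  exact: le_trans (hm s) su.
- have g0 : gd t (- 0%:Z) = t by rewrite oppr0 grid0.
  by rewrite (@indep t (m t) 0%N (hm t)) g0 ?Nid.
by move=> n u nu; exact: indep.
Qed.

Let C := 2 * p * (1 + 2 * p).

Let C1 : 2 <= C.
Proof. by have h := p1; rewrite /C; nra. Qed.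

(** The glued orbit of a small [z] stays in the ball where the cut-off is the
    identity, so its past is a true orbit of [N], which ends at the position
    before the kick.  [K * C] compares that orbit with [z], at all real times. *)
Lemma graph_sub_local_unstable t dlt : 0 < dlt -> dlt <= r ->
  graph_over (proj S t) (Sigma t) (dlt / (K * C)) `<=` local_unstable_set N dlt t.
Proof.
move=> dlt0 dltr _ [z /= zle <-].
have KC0 : 0 < K * C by rewrite mulr_gt0// (lt_le_trans _ K1, lt_le_trans _ C1).
have Cz : K * C * `|z| <= dlt by rewrite mulrC -ler_pdivlMr.
have Cz0 : 0 <= C * `|z| by rewrite mulr_ge0// (le_trans _ C1).
have Czr : C * `|z| <= r.
  by rewrite (le_trans _ (le_trans Cz dltr))// -mulrA ler_peMl.
have yle k : `|gorb t z k| <= C * `|z| * decay k := glued_orbit_le t z k.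
have yr k : `|gorb t z k| <= r.
  by rewrite (le_trans (yle k))// (le_trans _ Czr)// ler_piMr ?decay_le1.
have [_ rec] := glued_orbitP t z.
set z0 := proj S t z + Sigma t (proj S t z).
pose zs (n : nat) := if n is 0 then z0 else gorb t z (- n%:Z).
have hzs : backward_orbit tau N t zs.
  move=> n; have kE : - n.+1%:Z + 1 = - n%:Z by rewrite -addn1 PoszD opprD subrK.
  have := rec (- n.+1%:Z); rewrite kE /glued_deviation.
  rewrite (_ : - n.+1%:Z < 0) ?radial_id ?yr ?oppr_lt0//.
  have -> (a b c : X) : a + (b - a) + c = b + c by zmod_identity.
  rewrite kE /kick => rn; case: n {kE} rn => [|n].
    rewrite eqxx oppr0 /zs => rn.
    rewrite /z0 unstable_graph_proj /unstable_graph.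
    by rewrite [gorb t z 0]rn addrC subrK.
  by rewrite eqr_opp addr0 => rn; exact: esym.
have [zeta [glob zt zE]] := global_solution_of_backward_orbit hzs.
have zeta_le u : u <= t ->
    `|zeta u| <= K * C * `|z| * expR (- (ln 2 / tau) * (t - u)) /\
    `|zeta u| <= dlt.
  move=> ut; have [n [un tn en]] := grid_exists tau0 ut.
  have nu : gd t (- n.+1%:Z) <= u.
    by move: tn; rewrite /grid -addn1 PoszD opprD rmorphB/= rmorphN/=; lra.
  have un' : u <= gd t (- n.+1%:Z) + tau.
    by move: un; rewrite /grid -addn1 PoszD opprD rmorphB/= rmorphN/=; lra.
  have -> : zeta u = N u (gd t (- n.+1%:Z)) (zs n.+1) by exact: zE.
  have zn := yle (- n.+1%:Z).
  have dE : decay (- n.+1%:Z) = 2^-1 * 2^-1 ^+ n :> R.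
    by rewrite /decay -exprS abszN.
  have h1 := Nle nu un' (yr (- n.+1%:Z)).
  have h2 := ler_wpM2l K0 zn.
  have q0 : 0 <= K * (C * `|z|) by rewrite mulr_ge0.
  have half : 2^-1 * 2^-1 ^+ n <= 1 :> R.
    by rewrite -exprS exprn_ile1// invf_le1// ler1n.
  split; rewrite (le_trans h1)// (le_trans h2)// dE.
    by have := ler_wpM2l q0 en; lra.
  by rewrite (le_trans _ Cz)//; have := ler_wpM2l q0 half; lra.
exists zeta; split => //.
- by move=> u /zeta_le[].
apply/cvgr0Pnorm_lt => e e0.
pose c := K * C * `|z| + 1.
have c0 : 0 < c by rewrite ltr_wpDl// mulr_ge0// ltW.
have al0 : 0 < ln 2 / tau by rewrite divr_gt0// ln_gt0// ltr1n.
exists (Num.min t (t + ln (e / c) / (ln 2 / tau))); split; first exact: num_real.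
move=> u; rewrite lt_min => /andP[ut ue].
have [h _] := zeta_le _ (ltW ut).
rewrite (le_lt_trans h)// (@lt_le_trans _ _ (c * (e / c)))//; last first.
  by rewrite mulrC divfK ?gt_eqF.
have -> : e / c = expR (ln (e / c)) by rewrite lnK// posrE divr_gt0.
apply: (@le_lt_trans _ _ (c * expR (- (ln 2 / tau) * (t - u)))).
  by rewrite ler_wpM2r ?expR_ge0// lerDl.
rewrite ltr_pM2l// ltr_expR -ltrBlDl ltr_pdivlMr// in ue *.
by rewrite mulNr -mulrN opprB mulrC.
Qed.

(** Conversely, the past of a solution that stays in the ball, glued to the
    linear forward orbit of the stable part of its endpoint, is a bounded orbit
    kicked by minus the unstable part: by uniqueness, the glued orbit. *)
Lemma local_unstable_sub_graph t dlt : dlt <= r ->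
  local_unstable_set N dlt t `<=` graph_over (proj S t) (Sigma t) dlt.
Proof.
move=> dr z0 [zeta [glob zt zle _]].
have z0le : `|z0| <= dlt by rewrite -zt zle.
have [oc orec] := split_orbitP hyp tau0 hS t z0.
pose y (k : int) := if k < 0 then zeta (gd t k) else orb S t z0 k.
exists z0 => //.
rewrite unstable_graph_proj.
suff -> : Sigma t z0 = z0 - proj S t z0 by rewrite addrC subrK.
have -> : z0 - proj S t z0 = y 0 by rewrite /y ltxx /unstable_proj subKr.
congr (_ 0).
apply: (kicked_orbit_unique hyp (glued_small t) (glued_orbitP t z0)).
have yr k : k < 0 -> `|y k| <= r.
  move=> k0; rewrite /y k0 (le_trans (zle _ _))// -[leRHS](grid0 tau).
  by apply: grid_le => //; rewrite ltW.
split.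
  exists (r + 2 * p * `|z0|) => k; have [k0|k0] := ltP k 0.
    by rewrite (le_trans (yr _ k0))// lerDl !mulr_ge0// ltW.
  rewrite /y ltNge k0 /= (le_trans (split_orbit_le hyp tau0 hS _ _ _))//.
  rewrite (@le_trans _ _ (2 * p * `|z0|))// ?lerDr ?(ltW r0)//.
  by rewrite ler_piMr ?decay_le1// !mulr_ge0// ltW.
move=> k; have [k0|k0] := ltP k 0; last first.
  rewrite /glued_deviation ltNge k0 /= /y [k < 0]ltNge k0 /=.
  have -> : (k + 1 < 0) = false by rewrite ltNge addr_ge0.
  by rewrite orec /kick; case: eqP k0 => // ->.
rewrite /glued_deviation k0 radial_id ?yr//.
have -> (a b c : X) : a + (b - a) + c = b + c by zmod_identity.
rewrite {2}/y k0 (glob _ _ (gle t k)).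
have [->|k1] := eqVneq k (- 1).
  by rewrite addNr grid0 zt /y ltxx /kick eqxx /unstable_proj subKr.
by rewrite /kick (negbTE k1) addr0 /y -ltrBrDr sub0r lt_neqAle k1 -ltzD1 addNr k0.
Qed.

End graph.

Lemma unstable_proj_close S S' e t x : near_map L p tau K S ->
  near_map L p tau K S' ->
  (forall s x, `|S (s + tau) s x - S' (s + tau) s x| <= e * `|x|) ->
  `|proj S t x - proj S' t x| <= 16 * p ^+ 2 * e * `|x|.
Proof.
move=> hS hS' hd.
have e0 : 0 <= e * `|x| := le_trans (normr_ge0 _) (hd t x).
rewrite /unstable_proj.
have -> (a b : X) : x - a - (x - b) = - (a - b) by zmod_identity.
rewrite normrN.
have -> : 16 * p ^+ 2 * e * `|x| = 8 * p * (2 * p * (e * `|x|)) by ring.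
apply: (kicked_orbit_stable hyp (deviation_small hyp tau0 hS t)
  (split_orbitP hyp tau0 hS t x) (split_orbitP hyp tau0 hS' t x)).
  move=> k; set y := split_orbit _ _ _ _ _ k.
  have -> : deviation L tau S t k y - deviation L tau S' t k y =
      S (gd t k + tau) (gd t k) y - S' (gd t k + tau) (gd t k) y.
    by rewrite /deviation !gridS; zmod_identity.
  have hy : `|y| <= 2 * p * `|x|.
    rewrite (le_trans (split_orbit_le hyp tau0 hS' _ _ _))// ler_piMr ?decay_le1//.
    by rewrite !mulr_ge0// ltW.
  have [x0|x0] := eqVneq x 0.
    have -> : y = 0 by apply/eqP; rewrite -normr_le0 (le_trans hy)// x0 normr0 mulr0.
    by rewrite (le_trans (hd _ _))// x0 normr0 !mulr0.
  have {}e0 : 0 <= e by move: e0; rewrite pmulr_lge0// normr_gt0.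
  by rewrite (le_trans (hd _ _))// mulrCA ler_wpM2l.
by rewrite subrr normr0 mulr_ge0// mulr_ge0// ltW.
Qed.

Lemma unstable_graph_close S S' N N' e t z : near_map L p tau K S ->
  near_map L p tau K S' -> near_map_on_ball L p tau K r N ->
  near_map_on_ball L p tau K r N' -> 0 <= e ->
  (forall s x, `|S (s + tau) s x - S' (s + tau) s x| <= e * `|x|) ->
  (forall s x, `|x| <= r -> `|N (s + tau) s x - N' (s + tau) s x| <= e) ->
  `|unstable_graph L tau r S N t z - unstable_graph L tau r S' N' t z| <=
    128 * p ^+ 3 * e * (1 + `|z|).
Proof.
move=> hS hS' hN hN' e0 hd hdN.
have ez0 : 0 <= e * `|z| by rewrite mulr_ge0.
have -> : 128 * p ^+ 3 * e * (1 + `|z|) =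
  8 * p * (16 * p ^+ 2 * (e * (1 + `|z|))) by ring.
have pp : 1 <= p ^+ 2 by rewrite exprn_ege1.
have pp1 : p <= p ^+ 2 by rewrite expr2 ler_peMl// ltW.
have dlt0 a b : 0 <= a <= 16 * p ^+ 2 -> 0 <= b <= 16 * p ^+ 2 ->
    a * e + b * (e * `|z|) <= 16 * p ^+ 2 * (e * (1 + `|z|)).
  move=> /andP[a0 ale] /andP[b0 ble].
  by rewrite mulrDr mulr1 mulrDr lerD// ler_wpM2r.
apply: (kicked_orbit_stable hyp (glued_small hS hN t)
  (glued_orbitP hS hN t z) (glued_orbitP hS' hN' t z)).
  move=> k; set y := glued_orbit _ _ _ _ _ _ _ k; rewrite /glued_deviation.
  case: ifP => _.
    have -> (a b c : X) : a - c - (b - c) = a - b by zmod_identity.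
    rewrite gridS (le_trans (hdN _ _ (radial_le _ (ltW r0))))//.
    have := @dlt0 1 0; rewrite mul1r mul0r addr0; apply; lra.
  have -> : deviation L tau S t k y - deviation L tau S' t k y =
      S (gd t k + tau) (gd t k) y - S' (gd t k + tau) (gd t k) y.
    by rewrite /deviation !gridS; zmod_identity.
  have hy : `|y| <= 2 * p * (1 + 2 * p) * `|z|.
    rewrite (le_trans (glued_orbit_le hS' hN' _ _ _))// ler_piMr ?decay_le1//.
    by rewrite !mulr_ge0// ?addr_ge0 ?mulr_ge0// ltW.
  rewrite (le_trans (hd _ _))// (le_trans (ler_wpM2l e0 hy))// mulrCA.
  have := @dlt0 0 (2 * p * (1 + 2 * p)); rewrite mul0r add0r; apply.
    by rewrite lexx /=; lra.
  by have h := p1; apply/andP; split; nra.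
have -> (a b : X) : - a - - b = - (a - b) by zmod_identity.
rewrite normrN (le_trans (unstable_proj_close _ _ hS hS' hd))// -[leLHS]mulrA.
by have := @dlt0 0 (16 * p ^+ 2); rewrite mul0r add0r; apply; lra.
Qed.

End unstable_graph.

(** * Estimates for Bochner integrals and mild solutions *)

Section ereal_limits.
Context {R : realType} {T : Type} {F : set_system T} {FF : Filter F}.
Implicit Types (f : T -> \bar R).

Lemma cvge0_lt f (e : R) : f x @[x --> F] --> (0 : \bar R) -> 0 < e ->
  \forall x \near F, (f x < e%:E)%E.
Proof.
move=> hf e0; apply: (hf [set u | (u < e%:E)%E]).
by apply: open_ereal_lt'; rewrite lte_fin.
Qed.

Lemma cvge0_of_le f : (forall x, (0 <= f x)%E) ->
  (forall e : R, 0 < e -> \forall x \near F, (f x <= e%:E)%E) ->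
  f x @[x --> F] --> (0 : \bar R).
Proof.
move=> f0 fe; apply/fine_cvgP; split.
  apply: filterS (fe 1 ltr01) => x fx; rewrite ge0_fin_numE//.
  by rewrite (le_lt_trans fx)// ltry.
apply/cvgr0Pnorm_le => e e0; apply: filterS (fe e e0) => x fx /=.
rewrite ger0_norm ?fine_ge0// -lee_fin fineK// ge0_fin_numE//.
by rewrite (le_lt_trans fx)// ltry.
Qed.

End ereal_limits.

Section bochner.
Context {R : realType} {X : completeNormedModType R}.
Notation mu := (@lebesgue_measure R).

Let fine_measureDI (D E : set R) : measurable D -> measurable E ->
  (mu D < +oo)%E -> fine (mu D) = fine (mu (D `&` E)) + fine (mu (D `\` E)).
Proof.
move=> mD mE fD.
have fin A : measurable A -> A `<=` D -> mu A \is a fin_num.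
  move=> mA AD; rewrite ge0_fin_numE//; apply: le_lt_trans fD.
  by apply: le_measure => //; rewrite inE.
rewrite -fineD ?fin//; first by rewrite addeC -measureDI.
- exact: measurableI.
- exact: measurableD.
Qed.

(** The triangle inequality for integrals of simple functions, without first
    making the pieces [E i] disjoint: cut the domain along them one by one. *)
Lemma norm_integral_simple_le (I : Type) (s : seq I) (E : I -> set R)
    (x : I -> X) (D : set R) (c : X) (a : R -> \bar R) :
  measurable D -> (mu D < +oo)%E -> (forall i, measurable (E i)) ->
  measurable_fun D a ->
  (forall t, D t -> (`|c + \sum_(i <- s) (\1_(E i) t : R) *: x i|%:E <= a t)%E) ->
  (`|fine (mu D) *: c + \sum_(i <- s) fine (mu (D `&` E i)) *: x i|%:E
     <= \int[mu]_(t in D) a t)%E.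
Proof.
move=> mD fD mE; elim: s D c mD fD => [|i s ih] D c mD fD ma ha.
  rewrite big_nil addr0 normrZ ger0_norm ?fine_ge0// EFinM fineK ?ge0_fin_numE//.
  have -> : (mu D * `|c|%:E = \int[mu]_(t in D) cst `|c|%:E t)%E.
    by rewrite integral_cst// muleC.
  apply: ge0_le_integral => // [t _|t Dt]; first by rewrite lee_fin.
  by have := ha t Dt; rewrite big_nil addr0.
have mDI := measurableI _ _ mD (mE i); have mDD := measurableD mD (mE i).
have fDI : (mu (D `&` E i) < +oo)%E.
  by apply: le_lt_trans fD; apply: le_measure; rewrite ?inE//; exact: subIsetl.
have fDD : (mu (D `\` E i) < +oo)%E.
  by apply: le_lt_trans fD; apply: le_measure; rewrite ?inE//; exact: subDsetl.
have DE : D = (D `&` E i) `|` (D `\` E i) by rewrite setUIDK.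
have a0 t : D t -> (0 <= a t)%E by move=> /ha; apply: le_trans; rewrite lee_fin.
rewrite [X in (_ <= \int[_]_(t in X) _)%E]DE ge0_integral_setU//; first last.
- by rewrite disj_set2E setDE setIACA setICr setI0.
- by rewrite -DE.
- by rewrite -DE.
apply: le_trans (leeD (ih (D `&` E i) (c + x i) mDI fDI _ _)
  (ih (D `\` E i) c mDD fDD _ _)); first last.
- move=> t [Dt nEt]; have := ha t Dt; rewrite big_cons indicE memNset//.
  by rewrite scale0r add0r.
- by apply: measurable_funS ma => //; exact: subDsetl.
- move=> t [Dt Et]; have := ha t Dt; rewrite big_cons indicE mem_set//.
  by rewrite scale1r addrA.
- by apply: measurable_funS ma => //; exact: subIsetl.
rewrite -EFinD lee_fin; apply: le_trans (ler_normD _ _).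
apply: le_of_eq; congr `|_|.
rewrite big_cons addrACA -big_split /=.
have -> : \sum_(j <- s) (fine (mu (D `&` E i `&` E j)) *: x j +
      fine (mu ((D `\` E i) `&` E j)) *: x j) =
    \sum_(j <- s) fine (mu (D `&` E j)) *: x j.
  apply: eq_bigr => j _; rewrite -scalerDl; congr (_ *: _).
  have mDE := measurableI _ _ mD (mE j).
  have fDE : (mu (D `&` E j) < +oo)%E.
    by apply: le_lt_trans fD; apply: le_measure; rewrite ?inE//; exact: subIsetl.
  rewrite (@fine_measureDI (D `&` E j) (E i))//.
  by congr (fine (mu _) + fine (mu _)); [exact: setIAC|rewrite !setDE setIAC].
rewrite addrA; congr (_ + _).
rewrite (fine_measureDI mD (mE i) fD) scalerDl scalerDr; zmod_identity.
Qed.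

(** For two integrals at once, so that differences of solutions can be estimated
    without linearity of the integral: the simple approximations of both are put
    into one list. *)
Lemma bochner_dist_le (D : set R) (f f' : R -> X) (v v' : X) (c : R) :
  measurable D -> (mu D < +oo)%E -> 0 <= c ->
  is_bochner_integral D f v -> is_bochner_integral D f' v' ->
  (forall t, D t -> `|f t - f' t| <= c) -> `|v - v'| <= c * fine (mu D).
Proof.
move=> mD fD c0 [m [E [x [g [hE hg hg0 hv]]]]] [m' [E' [x' [g' [hE' hg' hg0' hv']]]]] hc.
pose w n := \sum_(i < m n) fine (mu (E n i)) *: x n i.
pose w' n := \sum_(i < m' n) fine (mu (E' n i)) *: x' n i.
have key n : (`|w n - w' n|%:E <= c%:E * mu D + \int[mu]_(t in D) g n t
    + \int[mu]_(t in D) g' n t)%E.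
  have [mg gle] := hg n; have [mg' gle'] := hg' n.
  have g0 t : D t -> (0 <= g n t)%E by move=> /gle; apply: le_trans; rewrite lee_fin.
  have g0' t : D t -> (0 <= g' n t)%E by move=> /gle'; apply: le_trans; rewrite lee_fin.
  have -> : (c%:E * mu D = \int[mu]_(t in D) cst c%:E t)%E by rewrite integral_cst.
  rewrite -ge0_integralD//.
  rewrite -ge0_integralD//; last 2 first.
  - by move=> t Dt; rewrite adde_ge0 ?g0//.
  - exact: emeasurable_funD.
  pose EE (i : nat + nat) := match i with inl i => E n i | inr i => E' n i end.
  pose xx (i : nat + nat) := match i with inl i => x n i | inr i => - x' n i end.
  pose s := map inl (index_iota 0 (m n)) ++ map inr (index_iota 0 (m' n)).
  have sumE (k : set R -> R) : \sum_(i <- s) k (EE i) *: xx i =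
      \sum_(i < m n) k (E n i) *: x n i - \sum_(i < m' n) k (E' n i) *: x' n i.
    rewrite big_cat !big_map /= !big_mkord -sumrN; congr (_ + _).
    by apply: eq_bigr => i _; rewrite scalerN.
  have mEE i : measurable (EE i).
    by case: i => i /=; [case: (hE n i)|case: (hE' n i)].
  have := @norm_integral_simple_le _ s EE xx D 0
    (fun t => c%:E + g n t + g' n t)%E mD fD mEE.
  rewrite scaler0 add0r.
  have -> : \sum_(i <- s) fine (mu (D `&` EE i)) *: xx i = w n - w' n.
    rewrite -(sumE (fun A => fine (mu A))); apply: eq_bigr => i _.
    by congr (fine (mu _) *: _); apply: setIidr;
      case: i => i /=; [case: (hE n i)|case: (hE' n i)].
  apply.
    by apply: emeasurable_funD => //; exact: emeasurable_funD.
  move=> t Dt; rewrite add0r (sumE (fun A => \1_A t)).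
  have := gle t Dt; have := gle' t Dt; set u := \sum_(i < m n) _; set u' := \sum_(i < _) _.
  move=> h' h.
  have -> : u - u' = (f t - f' t) - (f t - u) + (f' t - u') by zmod_identity.
  apply: (@le_trans _ _ (`|f t - f' t|%:E + `|f t - u|%:E + `|f' t - u'|%:E)%E).
    by rewrite -!EFinD lee_fin (le_trans (ler_normD _ _))// lerD2r ler_normB.
  by rewrite !leeD// lee_fin hc.
have fmD : mu D \is a fin_num by rewrite ge0_fin_numE.
apply/ler_addgt0Pr => e e0; have e4 : 0 < e / 4 by rewrite divr_gt0.
have n1 := cvge0_lt hg0 e4; have n2 := cvge0_lt hg0' e4.
move/cvgrPdist_lt: hv => /(_ _ e4) n3; move/cvgrPdist_lt: hv' => /(_ _ e4) n4.
have [n [h1 h2 h3 h4]] : exists n, [/\ (\int[mu]_(t in D) g n t < (e / 4)%:E)%E,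
    (\int[mu]_(t in D) g' n t < (e / 4)%:E)%E, `|v - w n| < e / 4 & `|v' - w' n| < e / 4].
  near \oo => n; exists n; split; near: n => //.
have : (`|w n - w' n|%:E <= c%:E * mu D + (e / 4)%:E + (e / 4)%:E)%E.
  by rewrite (le_trans (key n))// !leeD// ltW.
rewrite -(fineK fmD) -EFinM -!EFinD lee_fin /= => hw.
have -> : v - v' = (v - w n) + (w n - w' n) - (v' - w' n) by zmod_identity.
rewrite (le_trans (ler_normB _ _))// (le_trans (lerD (ler_normD _ _) (lexx _)))//.
lra.
Unshelve. all: by end_near. Qed.

Lemma bochner0 (D : set R) : is_bochner_integral D (fun=> 0 : X) 0.
Proof.
exists (fun=> 0%N), (fun _ _ => set0), (fun _ _ => 0), (fun _ _ => 0%E); split.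
- by move=> n i; split => //; rewrite measure0 ltry.
- by move=> n; split => [|t _]; [exact: measurable_cst|rewrite big_ord0 subr0 normr0].
- by under eq_fun do rewrite integral0; exact: cvg_cst.
- by under eq_fun do rewrite big_ord0; exact: cvg_cst.
Qed.

End bochner.

Section continuity.
Context {R : realType} {X : normedModType R}.

Lemma within_sub_norm_max (u u' : R -> X) (a : R) : 0 <= a ->
  {within [set t : R | 0 <= t], continuous u} ->
  {within [set t : R | 0 <= t], continuous u'} ->
  exists2 s, 0 <= s <= a &
    forall t, 0 <= t <= a -> `|u t - u' t| <= `|u s - u' s|.
Proof.
move=> a0 cu cu'.
have sub : `[0, a] `<=` [set t : R | 0 <= t].
  by move=> t /=; rewrite in_itv /= => /andP[].
have [|s] := @EVT_max R (fun t => `|u t - u' t|) 0 a a0.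
  move=> t; apply: cvg_norm; apply: cvgB.
    exact: (continuous_subspaceW sub cu).
  exact: (continuous_subspaceW sub cu').
by rewrite in_itv /= => sa hs; exists s.
Qed.

(** Continuous induction, applied at the first time where the norm reaches [c]. *)
Lemma within_norm_lt (u : R -> X) (a c : R) : 0 <= a ->
  {within [set t : R | 0 <= t], continuous u} -> `|u 0| < c ->
  (forall b, 0 <= b <= a -> (forall t, 0 <= t <= b -> `|u t| <= c) ->
    `|u b| < c) ->
  forall t, 0 <= t <= a -> `|u t| < c.
Proof.
move=> a0 cu u0 hu t1 t1a; rewrite ltNge; apply/negP => ct1.
have near_s (s e : R) : 0 <= s -> 0 < e -> exists2 dl, 0 < dl &
    forall t, 0 <= t -> `|s - t| < dl -> `|u s - u t| < e.
  move=> s0 e0; have /subspace_continuousP/(_ s s0) := cu.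
  move=> /cvgrPdist_lt/(_ e e0)/nbhs_ballP[dl /= dl0 hdl].
  exists dl => // t t0 st; apply: hdl => //.
pose A := [set t | 0 <= t <= a /\ c <= `|u t|].
have Anon : A !=set0 by exists t1.
have Alb : has_lbound A by exists 0 => t [/andP[]].
have hA : has_inf A by split.
have s0 : 0 <= inf A by apply: lb_le_inf => // t [/andP[]].
have sa : inf A <= a by apply: le_trans (ge_inf Alb (_ : A t1)) _ => //; case/andP: t1a.
have below t : 0 <= t -> t < inf A -> `|u t| < c.
  move=> t0 tA; rewrite ltNge; apply/negP => ct.
  have : inf A <= t by apply: ge_inf => //; split=> //; rewrite t0 (le_trans (ltW tA)).
  by rewrite leNgt tA.
have cs : c <= `|u (inf A)|.
  rewrite leNgt; apply/negP => uc.
  have e0 : 0 < c - `|u (inf A)| by rewrite subr_gt0.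
  have [dl dl0 hdl] := near_s _ _ s0 e0.
  have [t [/andP[t0 ta] ct] tdl] := inf_adherent dl0 hA.
  have st : inf A <= t by apply: ge_inf => //; split=> //; rewrite t0.
  have := hdl t t0; rewrite distrC ger0_norm ?subr_ge0// ltrBlDl => /(_ tdl) h.
  have := lerB_dist (u t) (u (inf A)); rewrite (distrC (u t)); lra.
have sc : `|u (inf A)| <= c.
  rewrite leNgt; apply/negP => uc.
  have e0 : 0 < `|u (inf A)| - c by rewrite subr_gt0.
  have [dl dl0 hdl] := near_s _ _ s0 e0.
  have sn0 : 0 < inf A.
    by rewrite lt_neqAle s0 andbT; apply/eqP => sE; move: uc; rewrite -sE ltNge ltW.
  pose t := Num.max 0 (inf A - dl / 2).
  have t0 : 0 <= t by rewrite le_max lexx.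
  have ts : t < inf A by rewrite gt_max sn0 /= gtrBl divr_gt0.
  have tdl : `|inf A - t| < dl.
    rewrite ger0_norm ?subr_ge0 ?ltW// ltrBlDl -ltrBlDr lt_max.
    by rewrite ltrD2l ltrN2 (_ : dl / 2 < dl) ?orbT//; lra.
  have h1 := hdl t t0 tdl; have h2 := below t t0 ts.
  by have := lerB_dist (u (inf A)) (u t); lra.
have : `|u (inf A)| < c.
  apply: hu => [|t /andP[t0]]; first by rewrite s0.
  by rewrite le_eqVlt => /orP[/eqP->//|tA]; rewrite ltW// below.
by rewrite ltNge cs.
Qed.

End continuity.

Lemma is_bochner_integral_eq (R : realType) (X : normedModType R) (D : set R)
    (f f' : R -> X) (v : X) : (forall t, D t -> f t = f' t) ->
  is_bochner_integral D f v -> is_bochner_integral D f' v.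
Proof.
move=> ff' [m [E [c [g [hE hg hg0 hv]]]]]; exists m, E, c, g; split=> // n.
have [mg gle] := hg n; split=> // t Dt.
by rewrite -ff'//; exact: gle.
Qed.

Section mild.
Context {R : realType} {X : completeNormedModType R}.
Variables (T : R -> X -> X) (K tau : R).
Hypothesis tau0 : 0 < tau.
Hypothesis K1 : 1 <= K.
Hypothesis linT : forall t, 0 <= t -> linear (T t).
Hypothesis Tle : forall t x, 0 <= t -> t <= tau -> `|T t x| <= K * `|x|.

(** The forcing [f] is a function of time, so that equations with different
    right-hand sides can be compared. *)
Definition duhamel (x : X) (u f : R -> X) (a : R) :=
  {within [set t : R | 0 <= t], continuous u} /\
  forall t, 0 <= t -> t <= a ->
    is_bochner_integral `[0, t] (fun r => T (t - r) (f r)) (u t - T t x).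

Lemma duhamel0 a : duhamel 0 (fun=> 0) (fun=> 0) a.
Proof.
split=> [|t t0 _]; first by move=> t; exact: cvg_cst.
rewrite (linear_map0 (linT t0)) subr0.
apply: (@is_bochner_integral_eq _ _ _ (fun=> 0)); last exact: bochner0.
by move=> r /=; rewrite in_itv /= => /andP[_ rt]; rewrite (linear_map0 (linT _)) ?subr_ge0.
Qed.

(** Gronwall's inequality on a short interval: the maximum of [u - u'] is
    attained and absorbs itself. *)
Lemma duhamel_compare (x x' : X) (u f u' f' : R -> X) (a eps kap : R) :
  0 <= a -> a <= tau -> duhamel x u f a -> duhamel x' u' f' a ->
  0 <= eps -> 0 <= kap -> 2 * K * tau * eps <= 1 ->
  (forall r, 0 <= r -> r <= a -> `|f r - f' r| <= eps * `|u r - u' r| + kap) ->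
  forall t, 0 <= t -> t <= a ->
    `|u t - u' t| <= 2 * K * (`|x - x'| + tau * kap) /\
    `|u t - u' t - T t (x - x')| <=
      K * tau * (eps * (2 * K * (`|x - x'| + tau * kap)) + kap).
Proof.
move=> a0 atau [cu hu] [cu' hu'] eps0 kap0 small hf.
have K0 : 0 <= K by exact: le_trans K1.
have [s /andP[s0 sa] smax] := within_sub_norm_max a0 cu cu'.
set m := `|u s - u' s| in smax *.
have m0 : 0 <= m by exact: normr_ge0.
have key t : 0 <= t -> t <= a ->
    `|u t - u' t - T t (x - x')| <= K * (eps * m + kap) * tau.
  move=> t0 ta.
  have -> : u t - u' t - T t (x - x') = (u t - T t x) - (u' t - T t x').
    by rewrite (linear_mapB (linT t0)); zmod_identity.
  have muE : lebesgue_measure (`[0, t]%classic : set R) = t%:E.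
    rewrite lebesgue_measure_itv /= lte_fin; case: ltP => [_|].
      by rewrite -EFinB subr0.
    by move=> t0'; congr (_%:E); apply/eqP; rewrite eq_le t0.
  have e0 : 0 <= K * (eps * m + kap) by rewrite mulr_ge0// addr_ge0// mulr_ge0.
  apply: (@le_trans _ _ (K * (eps * m + kap) * fine (lebesgue_measure (`[0, t]%classic : set R)))).
    apply: (bochner_dist_le _ _ e0 (hu t t0 ta) (hu' t t0 ta)) => //.
      by rewrite muE ltry.
    move=> r /=; rewrite in_itv /= => /andP[r0 rt].
    have tr : 0 <= t - r by rewrite subr_ge0.
    rewrite -(linear_mapB (linT tr)).
    have ra := le_trans rt ta.
    apply: (le_trans (Tle _ tr _)).
      by rewrite (le_trans _ atau)// (le_trans _ ta)// gerBl.
    rewrite ler_wpM2l// (le_trans (hf _ r0 ra))// lerD2r ler_wpM2l//.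
    by apply: smax; rewrite r0 ra.
  by rewrite muE /= ler_wpM2l// (le_trans ta).
have mle : m <= 2 * K * (`|x - x'| + tau * kap).
  have h1 := key s s0 sa.
  have h2 : `|T s (x - x')| <= K * `|x - x'| by apply: Tle => //; exact: le_trans atau.
  have h3 : m <= K * `|x - x'| + K * (eps * m + kap) * tau.
    apply: le_trans (lerD h2 h1); apply: le_trans (ler_normD _ _).
    by apply: le_of_eq; congr `|_|; zmod_identity.
  have h4 : 2 * K * tau * eps * m <= m by rewrite ler_piMl.
  lra.
move=> t t0 ta; split; first by rewrite (le_trans _ mle)// smax// t0.
rewrite (le_trans (key t t0 ta))//.
have h : eps * m <= eps * (2 * K * (`|x - x'| + tau * kap)) by rewrite ler_wpM2l.
have q0 : 0 <= K * tau by rewrite mulr_ge0// ltW.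
have := ler_wpM2l q0 h; lra.
Qed.

Lemma duhamel_bound (x : X) (u f : R -> X) (a eps : R) :
  0 <= a -> a <= tau -> duhamel x u f a -> 0 <= eps -> 2 * K * tau * eps <= 1 ->
  (forall r, 0 <= r -> r <= a -> `|f r| <= eps * `|u r|) ->
  forall t, 0 <= t -> t <= a -> `|u t| <= 2 * K * `|x| /\
    `|u t - T t x| <= 2 * K ^+ 2 * tau * eps * `|x|.
Proof.
move=> a0 atau hu eps0 small hf t t0 ta.
have [r r0 ra|] := duhamel_compare a0 atau hu (duhamel0 a) eps0 (lexx 0) small _ t0 ta.
  by rewrite !subr0 addr0; exact: hf.
rewrite !subr0 mulr0 !addr0 => h1 h2; split=> //.
by rewrite (le_trans h2)//; apply: le_of_eq; ring.
Qed.

(** A priori, solutions that start well inside a ball cannot leave it within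
    time [tau], so that only the behaviour of the field on the ball matters. *)
Lemma duhamel_stays (F : R -> X -> X) (x : X) (u : R -> X) (rho eps : R) :
  0 < rho -> duhamel x u (fun r => F r (u r)) tau -> u 0 = x ->
  0 <= eps -> 2 * K * tau * eps <= 1 ->
  (forall r z, `|z| <= rho -> `|F r z| <= eps * `|z|) -> 4 * K * `|x| <= rho ->
  forall t, 0 <= t -> t <= tau -> `|u t| <= 2 * K * `|x| /\ `|u t| <= rho.
Proof.
move=> rho0 hu u0 eps0 small hF xrho.
have K0 : 0 <= K by exact: le_trans K1.
have Kx : 0 <= K * `|x| by rewrite mulr_ge0.
have bnd b t : b <= tau -> (forall r, 0 <= r <= b -> `|u r| <= rho) ->
    0 <= t -> t <= b -> `|u t| <= 2 * K * `|x|.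
  move=> btau ub t0 tb; have b0 := le_trans t0 tb.
  have hub : duhamel x u (fun r => F r (u r)) b.
    by split=> [|r r0 rb]; [exact: hu.1|apply: hu.2 => //; exact: le_trans btau].
  have [r r0 rb|//] := duhamel_bound b0 btau hub eps0 small _ t0 tb.
  by apply: hF; apply: ub; rewrite r0.
have stay : forall t, 0 <= t <= tau -> `|u t| < rho.
  apply: within_norm_lt (ltW tau0) hu.1 _ _.
    rewrite u0; have : `|x| <= K * `|x| by rewrite ler_peMl.
    lra.
  move=> b /andP[b0 btau] ub.
  have := bnd b b btau ub b0 (lexx _); lra.
move=> t t0 ta; split.
  by apply: (bnd tau) => // r ra; exact: ltW (stay _ ra).
by apply: ltW; apply: stay; rewrite t0.
Qed.

End mild.

(** * Time steps of the linear and nonlinear cocycles *)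

Section flows.
Context {R : realType} {d : measure_display} {Omega : measurableType d}.
Context {X : completeNormedModType R}.
Variables (theta : R -> Omega -> Omega) (T : R -> X -> X).
Hypothesis flow : random_flow theta.
Implicit Types (w : R * Omega).

Lemma Theta0 w : Theta theta 0 w = w.
Proof. by case: flow => h _ _; case: w => t o; rewrite /Theta /= add0r h. Qed.

Lemma ThetaD t s w : Theta theta t (Theta theta s w) = Theta theta (t + s) w.
Proof. by case: flow => _ h _; rewrite /Theta /= h addrA. Qed.

Lemma process_evolution psi w : cocycle theta psi ->
  evolution (process theta psi w : R -> R -> X -> X).
Proof.
move=> [h0 hD _]; split=> [t x|r s t x rs st]; rewrite /process.
  by rewrite subrr h0.
have -> : t - r = (t - s) + (s - r) by ring.
rewrite (hD (t - s) (s - r)) ?subr_ge0// ThetaD.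
by congr (psi _ (Theta theta _ _) _); ring.
Qed.

Lemma cocycle_within psi w (x : X) : cocycle theta psi ->
  {within [set t : R | 0 <= t], continuous (fun t => psi t w x)}.
Proof.
move=> [_ _ /(_ w) /subspace_continuousP cpsi].
apply/subspace_continuousP => t /= t0.
have := cpsi (t, x) t0 => ct P /ct /nbhs_ballP[e /= e0 he].
apply/nbhs_ballP; exists e => //= s ts s0.
by apply: (he (s, x)) => //; split=> //=; exact: ballxx.
Qed.

Variables (K tau : R).
Hypothesis tau0 : 0 < tau.
Hypothesis K1 : 1 <= K.
Hypothesis linT : forall t, 0 <= t -> linear (T t).
Hypothesis Tle : forall t x, 0 <= t -> t <= tau -> `|T t x| <= K * `|x|.

Let K0 : 0 <= K. Proof. exact: le_trans K1. Qed.

Lemma linear_part_duhamel B phi w x a : linear_part theta T B phi ->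
  duhamel T x (fun t => phi t w x) (fun r => B (Theta theta r w) (phi r w x)) a.
Proof.
move=> [_ coc hint]; split=> [|t t0 _]; first exact: cocycle_within.
have := hint w 0 t x t0; rewrite /process !subr0 Theta0.
by apply: is_bochner_integral_eq => r _; rewrite subr0.
Qed.

Lemma linear_part_near B phi w eps : linear_part theta T B phi ->
  (forall r z, `|B (Theta theta r w) z| <= eps * `|z|) -> 0 <= eps ->
  2 * K * tau * eps <= 1 ->
  forall s t x, 0 <= t -> t <= tau ->
    `|phi t (Theta theta s w) x| <= 2 * K * `|x| /\
    `|phi t (Theta theta s w) x - T t x| <= 2 * K ^+ 2 * tau * eps * `|x|.
Proof.
move=> hphi hB eps0 small s t x t0 tt.
apply: (duhamel_bound tau0 K1 linT Tle (ltW tau0) (lexx tau)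
  (linear_part_duhamel (Theta theta s w) x tau hphi) eps0 small) => // r _ _.
by rewrite ThetaD.
Qed.

Lemma linear_part_near_map B phi w eps p : linear_part theta T B phi ->
  (forall r z, `|B (Theta theta r w) z| <= eps * `|z|) -> 0 <= eps ->
  2 * K * tau * eps <= 1 -> 2 * K ^+ 2 * tau * eps <= (32 * p)^-1 ->
  near_map (T tau) p tau (2 * K) (process theta phi w).
Proof.
move=> hphi hB eps0 small small2; have [bl coc _] := hphi.
have near := linear_part_near hphi hB eps0 small.
split; first exact: process_evolution.
- by move=> s t st; have [] := bl (t - s) (Theta theta s w); rewrite ?subr_ge0.
- move=> s t x st ts; rewrite /process.
  by have [] := near s (t - s) x; rewrite ?subr_ge0// lerBlDl.
move=> s x; rewrite /process.
have -> : s + tau - s = tau by ring.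
have [_ h] := near s tau x (ltW tau0) (lexx _).
by rewrite (le_trans h)// ler_wpM2r.
Qed.

Section nonlinear.
Variables (B h : R * Omega -> X -> X) (psi : R -> R * Omega -> X -> X).
Variables (w : R * Omega) (eps rho : R).
Hypothesis wp : mild_well_posed theta T B h psi.
Hypothesis coc : cocycle theta psi.
Hypothesis rho0 : 0 < rho.
Hypothesis eps0 : 0 <= eps.
Hypothesis small : 2 * K * tau * eps <= 1.

Let F v r z := B (Theta theta r v) z + h (Theta theta r v) z.

Hypothesis F0 : forall r, F w r 0 = 0.
Hypothesis Flip : forall r z z', `|z| <= rho -> `|z'| <= rho ->
  `|F w r z - F w r z'| <= eps * `|z - z'|.

Let FD s r z : F (Theta theta s w) r z = F w (r + s) z.
Proof. by rewrite /F ThetaD. Qed.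

Let Fle s r z : `|z| <= rho -> `|F (Theta theta s w) r z| <= eps * `|z|.
Proof.
move=> zr; have := @Flip (r + s) z 0 zr; rewrite FD F0 !subr0; apply.
by rewrite normr0 ltW.
Qed.

Lemma mild_duhamel v x : duhamel T x (fun t => psi t v x)
  (fun r => F v r (psi r v x)) tau.
Proof.
have [[cu hu] _] := wp v x; split=> // t t0 _; exact: hu.
Qed.

Let psi0 v x : psi 0 v x = x. Proof. by case: coc. Qed.

Lemma mild_zero v t : (forall r, F v r 0 = 0) -> 0 <= t -> psi t v 0 = 0.
Proof.
move=> Fv t0; have [_ uniq] := wp v 0; apply/esym.
apply: (uniq (fun=> 0)) => //; split=> [r|r r0]; first exact: cvg_cst.
rewrite (linear_map0 (linT r0)) subr0.
apply: (@is_bochner_integral_eq _ _ _ (fun=> 0)); last exact: bochner0.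
move=> q; rewrite /= in_itv /= => /andP[_ qr].
by have := Fv q; rewrite /F => ->; rewrite (linear_map0 (linT _))// subr_ge0.
Qed.

Lemma mild_stays s t x : 0 <= t -> t <= tau -> 4 * K * `|x| <= rho ->
  `|psi t (Theta theta s w) x| <= 2 * K * `|x| /\
  `|psi t (Theta theta s w) x| <= rho.
Proof.
move=> t0 tt xr.
by apply: (duhamel_stays tau0 K1 linT Tle rho0 (mild_duhamel _ _) (psi0 _ _)
  eps0 small (@Fle s) xr t0 tt).
Qed.

Lemma mild_near_map_on_ball p : 2 * K ^+ 2 * tau * eps <= (64 * p)^-1 ->
  near_map_on_ball (T tau) p tau (2 * K) (rho / (4 * K)) (process theta psi w).
Proof.
have K4 : 0 < 4 * K by rewrite mulr_gt0// (lt_le_trans ltr01).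
move=> small2; split; first exact: process_evolution.
- move=> s t st; rewrite /process; apply: mild_zero; last by rewrite subr_ge0.
  by move=> r; rewrite FD.
- move=> s t x st ts xr; rewrite /process.
  rewrite ler_pdivlMr// mulrC in xr.
  by have [] := mild_stays s (_ : 0 <= t - s) _ xr; rewrite ?subr_ge0 ?lerBlDl.
move=> s x x' xr xr'; rewrite /process.
have -> : s + tau - s = tau by ring.
rewrite !ler_pdivlMr// !(mulrC _ (4 * K)) in xr xr'.
have [r r0 rt|_ h1] := duhamel_compare tau0 K1 linT Tle (ltW tau0) (lexx tau)
  (mild_duhamel (Theta theta s w) x) (mild_duhamel (Theta theta s w) x') eps0
  (lexx 0) small _ (ltW tau0) (lexx tau).
  rewrite addr0 !FD; apply: Flip.
    by have [] := mild_stays s r0 rt xr.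
  by have [] := mild_stays s r0 rt xr'.
rewrite (le_trans h1)//.
have -> : K * tau * (eps * (2 * K * (`|x - x'| + tau * 0)) + 0) =
  2 * K ^+ 2 * tau * eps * `|x - x'| by ring.
by rewrite ler_wpM2r.
Qed.

End nonlinear.

Lemma mild_close B h psi B' h' psi' w eps eps' rho kap :
  mild_well_posed theta T B h psi -> cocycle theta psi ->
  mild_well_posed theta T B' h' psi' -> cocycle theta psi' ->
  0 < rho -> 0 <= eps -> 0 <= eps' -> 0 <= kap ->
  2 * K * tau * eps <= 1 -> 2 * K * tau * eps' <= 1 ->
  let F r z := B (Theta theta r w) z + h (Theta theta r w) z in
  let F' r z := B' (Theta theta r w) z + h' (Theta theta r w) z in
  (forall r, F r 0 = 0) -> (forall r, F' r 0 = 0) ->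
  (forall r z z', `|z| <= rho -> `|z'| <= rho ->
    `|F r z - F r z'| <= eps * `|z - z'|) ->
  (forall r z z', `|z| <= rho -> `|z'| <= rho ->
    `|F' r z - F' r z'| <= eps' * `|z - z'|) ->
  (forall r z, `|z| <= rho -> `|F r z - F' r z| <= kap) ->
  forall s x, `|x| <= rho / (4 * K) ->
    `|process theta psi w (s + tau) s x - process theta psi' w (s + tau) s x|
      <= 2 * K * tau * kap.
Proof.
move=> wp coc wp' coc' rho0 eps0 eps'0 kap0 small small' F F' F0 F'0 Flip F'lip FF'.
move=> s x xr; rewrite /process.
have -> : s + tau - s = tau by ring.
have K4 : 0 < 4 * K by rewrite mulr_gt0// (lt_le_trans ltr01).
rewrite ler_pdivlMr// mulrC in xr.
have [|h1 _] := duhamel_compare tau0 K1 linT Tle (ltW tau0) (lexx tau)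
  (mild_duhamel wp (Theta theta s w) x) (mild_duhamel wp' (Theta theta s w) x) eps0
  kap0 small _ (ltW tau0) (lexx tau); last first.
  rewrite (le_trans h1)// subrr normr0 add0r.
  by apply: le_of_eq; ring.
move=> r r0 rt; rewrite !ThetaD.
have [_ ur] := mild_stays wp coc rho0 eps0 small F0 Flip s r0 rt xr.
have [_ ur'] := mild_stays wp' coc' rho0 eps'0 small' F'0 F'lip s r0 rt xr.
set u := psi r _ x in ur *; set u' := psi' r _ x in ur' *.
have -> : B (Theta theta (r + s) w) u + h (Theta theta (r + s) w) u -
    (B' (Theta theta (r + s) w) u' + h' (Theta theta (r + s) w) u') =
    (F (r + s) u - F (r + s) u') + (F (r + s) u' - F' (r + s) u').
  by rewrite /F /F'; zmod_identity.
by rewrite (le_trans (ler_normD _ _))// lerD ?Flip ?FF'.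
Qed.

End flows.

(** * Differentiable maps on balls *)

Section mean_value.
Context {R : realType} {X : normedModType R}.

(** A local Lipschitz bound propagates: the first time after which it fails
    globally would be a time around which it fails locally. *)
Lemma lipschitz_of_local (g : R -> X) (k : R) :
  (forall s, 0 <= s <= 1 -> exists2 dl, 0 < dl & forall t, 0 <= t <= 1 ->
     `|t - s| < dl -> `|g t - g s| <= k * `|t - s|) ->
  `|g 1 - g 0| <= k.
Proof.
move=> loc; rewrite leNgt; apply/negP => k1.
pose A := [set t | 0 <= t <= 1 /\ k * t < `|g t - g 0|].
have A1 : A 1 by split; [rewrite ler01 lexx|rewrite mulr1].
have Alb : has_lbound A by exists 0 => t [/andP[]].
have hA : has_inf A by split=> //; exists 1.
have s0 : 0 <= inf A by apply: lb_le_inf; [exists 1|move=> t [/andP[]]].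
have s1 : inf A <= 1 by exact: ge_inf.
have [dl dl0 hdl] := loc (inf A) (introT andP (conj s0 s1)).
have below t : 0 <= t -> t < inf A -> `|g t - g 0| <= k * t.
  move=> t0 tA; rewrite leNgt; apply/negP => kt.
  have : inf A <= t by apply: ge_inf => //; split=> //; rewrite t0 (le_trans (ltW tA)).
  by rewrite leNgt tA.
have at_inf : `|g (inf A) - g 0| <= k * inf A.
  have [<-|sn0] := eqVneq 0 (inf A); first by rewrite subrr normr0 mulr0.
  have {}sn0 : 0 < inf A by rewrite lt_neqAle sn0.
  pose t := Num.max 0 (inf A - dl / 2).
  have t0 : 0 <= t by rewrite le_max lexx.
  have ts : t < inf A by rewrite gt_max sn0 /= gtrBl divr_gt0.
  have tdl : `|t - inf A| < dl.
    rewrite distrC ger0_norm ?subr_ge0 ?ltW// ltrBlDl -ltrBlDr lt_max.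
    by rewrite ltrD2l ltrN2 (_ : dl / 2 < dl) ?orbT//; lra.
  have := hdl t _ tdl; rewrite t0 (le_trans (ltW ts) s1) => /(_ isT).
  rewrite (distrC t) (distrC (g t)) (ger0_norm (ltW _)) ?subr_gt0// => h1.
  have h2 := below t t0 ts.
  have := ler_distD (g t) (g (inf A)) (g 0); lra.
have [t [/andP[t0 t1] kt] tdl] := inf_adherent dl0 hA.
have st : inf A <= t by apply: ge_inf => //; split=> //; rewrite t0.
have := hdl t _ _; rewrite t0 t1 ger0_norm ?subr_ge0// ltrBlDl => /(_ isT tdl) h.
have := ler_distD (g (inf A)) (g t) (g 0); lra.
Qed.

Lemma mean_value_ball (f : X -> X) (rho c : R) :
  (forall z, differentiable f z) ->
  (forall z v, `|z| <= rho -> `|'d f z v| <= c * `|v|) ->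
  forall x y, `|x| <= rho -> `|y| <= rho -> `|f x - f y| <= c * `|x - y|.
Proof.
move=> df hf x y xr yr.
have [->|xy] := eqVneq x y; first by rewrite !subrr !normr0 mulr0.
have n0 : 0 < `|x - y| by rewrite normr_gt0 subr_eq0.
apply/ler_addgt0Pr => e e0.
pose g t := f (y + t *: (x - y)).
have -> : f x - f y = g 1 - g 0 by rewrite /g scale1r scale0r addr0 subrKC.
apply: lipschitz_of_local => s /andP[s0 s1].
set z := y + s *: (x - y).
have zr : `|z| <= rho.
  have -> : z = (1 - s) *: y + s *: x.
    by rewrite /z scalerBl scalerBr scale1r; zmod_identity.
  rewrite (le_trans (ler_normD _ _))// !normrZ !ger0_norm ?subr_ge0//.
  have -> : rho = (1 - s) * rho + s * rho by ring.
  by rewrite lerD// ler_wpM2l// subr_ge0.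
have /diff_locallyP[_ /eqaddoP] := df z.
move=> /(_ (e / `|x - y|) (divr_gt0 e0 n0)) /nbhs_ballP[dl /= dl0 hdl].
exists (dl / `|x - y|); first by rewrite divr_gt0.
move=> t _ ts.
have tz : y + t *: (x - y) = (t - s) *: (x - y) + z.
  by rewrite /z scalerBl; zmod_identity.
have bz : ball (0 : X) dl ((t - s) *: (x - y)).
  by rewrite -ball_normE /= sub0r normrN normrZ -ltr_pdivlMr.
have h1 : `|g t - (f z + 'd f z ((t - s) *: (x - y)))| <=
    e / `|x - y| * `|(t - s) *: (x - y)| by rewrite /g tz; exact: (hdl _ bz).
have -> : g t - g s = (g t - (f z + 'd f z ((t - s) *: (x - y)))) +
    'd f z ((t - s) *: (x - y)) by rewrite -/z /g -/z; zmod_identity.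
rewrite (le_trans (ler_normD _ _))//.
apply: (le_trans (lerD h1 (hf z _ zr))).
rewrite normrZ; apply: le_of_eq; field.
by rewrite gt_eqF.
Qed.

Lemma C1_small_derivative (f : X -> X) (e : R) : C1 f ->
  (forall v, 'd f (0 : X) v = 0) -> 0 < e ->
  exists2 rho, 0 < rho & forall z v, `|z| <= rho -> `|'d f z v| <= e * `|v|.
Proof.
move=> [_ /(_ 0) cf] d0 e0.
have /nbhs_ballP[rho /= rho0 hrho] := cvge0_lt cf e0.
exists (rho / 2) => [|z v zr]; first by rewrite divr_gt0.
have bz : ball (0 : X) rho z.
  by rewrite -ball_normE /= sub0r normrN (le_lt_trans zr)//; lra.
have /ltW hz := hrho z bz.
have lin : linear (fun x => 'd f z x - 'd f (0 : X) x).
  by apply: linear_map_sub; exact: linearP.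
by have := le_opnorm lin hz v; rewrite d0 subr0.
Qed.

End mean_value.

(** * Hyperbolic semigroups *)

Section semigroup.
Context {R : realType} {X : completeNormedModType R}.
Variables (T : R -> X -> X) (Pi0 : X -> X).
Hypothesis hT : C0_semigroup T.
Hypothesis hyp0 : exp_dichotomy (fun t s : R => T (t - s)) (fun=> Pi0).

Lemma semigroup_linear t : 0 <= t -> linear (T t).
Proof. by case: hT => /(_ t) h _ _ _ /h[]. Qed.

(** The inverse on the unstable range, extended by [Pi0] to a linear map of the
    whole space. *)
Lemma dichotomy_inverse : exists M alpha : R, [/\ 1 <= M, 0 < alpha &
  forall t, 0 <= t ->
   [/\ forall x, T t (Pi0 x) = Pi0 (T t x),
       forall x, `|T t (x - Pi0 x)| <= M * expR (- alpha * t) * `|x| &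
       exists J : X -> X, [/\ linear J, forall x, Pi0 (J x) = J x,
         forall x, T t (J x) = Pi0 x, forall x, J (T t x) = Pi0 x &
         forall x, `|J x| <= M * expR (- alpha * t) * `|x|]]].
Proof.
have [hP [M [alpha [M1 alpha0 hM]]]] := hyp0.
have [[linP _] PP] := hP 0.
exists M, alpha; split=> // t t0.
have linTt := semigroup_linear t0.
have [] := hM 0 t t0; rewrite !subr0 sub0r => com bij st un.
have TP x : T t (Pi0 x) = Pi0 (T t x).
  have := com x; rewrite (linear_mapB linTt) => h.
  by apply: oppr_inj; apply: (addrI (T t x)).
split=> [//|x|].
  apply: (le_opnorm _ st) => a u v.
  by rewrite -linTt (linear_mapD linP) (linear_mapZ linP) scalerBr; congr (T t _); zmod_identity.
set J := 'pinv_(fun=> 0) (range Pi0) (T t) in un.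
have [fn inj sur] := bij.
have JK x : J (T t (Pi0 x)) = Pi0 x by rewrite /J pinvKV// inE; exists x.
have KJ x : exists y, J (Pi0 x) = Pi0 y /\ T t (Pi0 y) = Pi0 x.
  have [_ [y _ <-] Ty] := sur (Pi0 x) (ex_intro2 _ _ x I erefl).
  by exists y; rewrite -Ty JK.
have linJ : linear (J \o Pi0).
  move=> a u v /=.
  have [u' [-> Tu]] := KJ u; have [v' [-> Tv]] := KJ v.
  by rewrite (linear_mapD linP) (linear_mapZ linP) -Tu -Tv -linTt -linP JK.
exists (J \o Pi0); split => //= x.
- by have [y [-> _]] := KJ x; rewrite PP.
- by have [y [-> ->]] := KJ x.
- by rewrite -TP JK.
by have := le_opnorm linJ un x; rewrite mulrN mulNr.
Qed.

(** Boundedness on compact time intervals: the dichotomy bounds the stable part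
    directly, and the unstable part by pulling back its image at the end time. *)
Lemma hyperbolic_time_step : exists (tau p K : R) (J : X -> X),
  [/\ 0 < tau, 1 <= K, hyperbolic_map (T tau) Pi0 J p &
      forall t x, 0 <= t -> t <= tau -> `|T t x| <= K * `|x|].
Proof.
have [M [alpha [M1 alpha0 hM]]] := dichotomy_inverse.
have [hP _] := hyp0; have [blP PP] := hP 0; have [linP _] := blP.
have [cP cP0 hcP] := bounded_linear_bound blP.
have M0 : 0 < M by exact: lt_le_trans M1.
(* chosen so that M e^(- alpha tau) = 1/16 *)
pose tau := ln (16 * M) / alpha.
have tau0 : 0 < tau by rewrite divr_gt0// ln_gt0//; lra.
have rate : M * expR (- alpha * tau) = 16^-1.
  rewrite /tau mulNr mulrC [alpha * _]mulrC divfK ?gt_eqF// expRN lnK ?posrE ?mulr_gt0//.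
  by field; rewrite gt_eqF.
have [TP st [J [linJ PJ TJ JT Jle]]] := hM tau (ltW tau0).
rewrite !rate in st Jle.
have blT : bounded_linear (T tau) by case: hT => h _ _ _; exact: h (ltW tau0).
have [cT cT0 hcT] := bounded_linear_bound blT.
exists tau, (1 + cP), (M + M * (cT * cP)), J; split=> //.
- by rewrite (le_trans M1)// lerDl !mulr_ge0// ltW.
- split => //.
  + by case: blT.
  + by rewrite lerDl.
  + by move=> x; rewrite mulrDl mul1r (le_trans (ler_normB _ _))// lerD2l.
move=> t x t0 tt.
have [_ stt _] := hM t t0.
have tt0 : 0 <= tau - t by rewrite subr_ge0.
have [TP' _ [J' [_ _ _ J'T J'le]]] := hM _ tt0.
have e1 s : 0 <= s -> M * expR (- alpha * s) <= M.
  by move=> s0; rewrite ler_piMr ?(ltW M0)// expR_le1 mulNr oppr_le0 mulr_ge0// ltW.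
have -> : T t x = T t (x - Pi0 x) + T t (Pi0 x).
  by rewrite -(linear_mapD (semigroup_linear t0)) subrK.
rewrite (le_trans (ler_normD _ _))// mulrDl lerD//.
  by rewrite (le_trans (stt x))// ler_wpM2r// e1.
have -> : T t (Pi0 x) = J' (T tau (Pi0 x)).
  have [_ _ TD _] := hT.
  have -> : tau = (tau - t) + t by rewrite subrK.
  rewrite TD// J'T.
  by have [TPt _ _] := hM t t0; rewrite -TPt PP.
rewrite (le_trans (J'le _))//.
apply: (@le_trans _ _ (M * `|T tau (Pi0 x)|)); first by rewrite ler_wpM2r// e1.
rewrite -!mulrA ler_wpM2l ?(ltW M0)// (le_trans (hcT _))// ler_wpM2l//.
Qed.

End semigroup.

(** * Perturbations of an autonomous hyperbolic equation *)

Section autonomous.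
Context {R : realType} {X : completeNormedModType R}.
Variables (T : R -> X -> X) (Pi0 J : X -> X) (p tau K : R).
Hypothesis hT : C0_semigroup T.
Hypothesis hyp0 : exp_dichotomy (fun t s : R => T (t - s)) (fun=> Pi0).
Hypothesis hyp : hyperbolic_map (T tau) Pi0 J p.
Hypothesis tau0 : 0 < tau.
Hypothesis K1 : 1 <= K.

(** Iterating [J] produces the backward orbits. *)
Lemma unstable_proj_autonomous S t : near_map (T tau) p tau K S ->
  (forall s t x, s <= t -> S t s x = T (t - s) x) ->
  unstable_proj (T tau) tau S t = Pi0.
Proof.
move=> hS ST; apply/funext => x.
have [M [alpha [M1 alpha0 hM]]] := dichotomy_inverse hT hyp0.
have PP := hyp_PP hyp; have PJ := hyp_PJ hyp.
rewrite /unstable_proj -{2}[x](subrK (Pi0 x)).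
rewrite (linear_mapD (split_orbit_linear hyp tau0 hS t 0)).
rewrite (forward_bounded_split hyp tau0 K1 hS (c := M * `|x|)); last first.
  move=> n; have tn : t <= grid tau t n.
    by rewrite -[leLHS](grid0 tau); apply: grid_le.
  have tn0 : 0 <= grid tau t n - t by rewrite subr_ge0.
  have [_ st _] := hM _ tn0; rewrite ST// (le_trans (st x))// ler_wpM2r//.
  rewrite ler_piMr ?(le_trans _ M1)// expR_le1 mulNr oppr_le0.
  by rewrite mulr_ge0// ltW.
pose z n := iter n J (Pi0 x).
have Pz n : Pi0 (z n) = z n by case: n => [|n] /=; rewrite ?PP ?PJ.
rewrite (backward_bounded_split hyp tau0 K1 hS (z := z) (c := `|Pi0 x|)).
- zmod_identity.
- move=> n; rewrite ST; last by apply: grid_le => //; rewrite lerN2 lez_nat.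
  have -> : grid tau t (- n%:Z) - grid tau t (- n.+1%:Z) = tau.
    have -> : - n.+1%:Z = - n%:Z - 1 by rewrite -addn1 PoszD opprD.
    by rewrite /grid rmorphB/= rmorphN/=; ring.
  by rewrite /z /= (hyp_LJ hyp) Pz.
elim=> [//|n ih]; rewrite (le_trans (hyp_Jle hyp _))//.
have := normr_ge0 (z n); lra.
Qed.

End autonomous.

Section orbit_limits.
Context {R : realType} {d : measure_display} {Omega : measurableType d}.
Context {X : completeNormedModType R}.
Variables (theta : R -> Omega -> Omega) (w : R * Omega).

Lemma at_right0_exists (P : set R) : (\forall x \near (0 : R)^'+, P x) ->
  exists e, 0 < e <= 1 /\ forall x, 0 < x <= e -> P x.
Proof.
move=> /nbhs_ballP[e /= e0 he]; exists (Num.min 1 (e / 2)); split.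
  by rewrite lt_min ltr01 divr_gt0//= ge_min lexx.
move=> x /andP[x0]; rewrite le_min => /andP[_ xe]; apply: he => //.
by rewrite -ball_normE /= sub0r normrN gtr0_norm//; lra.
Qed.

Lemma at_right0_unit : \forall eta \near (0 : R)^'+, 0 <= eta <= 1.
Proof.
near=> eta; apply/andP; split; near: eta.
  by apply: filterS (nbhs_right_gt 0) => eta; exact: ltW.
exact: nbhs_right_le.
Unshelve. all: by end_near. Qed.

Lemma linear_perturbation_near (B : R -> R * Omega -> X -> X) (e : R) :
  (forall (eta : R) w, 0 <= eta <= 1 -> bounded_linear (B eta w)) ->
  ereal_sup (range (fun t : R => opnorm (B eta (Theta theta t w))))
       @[eta --> (0 : R)^'+] --> (0 : \bar R) -> 0 < e ->
  \forall eta \near (0 : R)^'+,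
    forall t z, `|B eta (Theta theta t w) z| <= e * `|z|.
Proof.
move=> hB hlim e0; near=> eta => t z.
have eta01 : 0 <= eta <= 1 by near: eta; exact: at_right0_unit.
apply: le_opnorm; first by case: (hB eta (Theta theta t w) eta01).
apply: (@le_trans _ _ (ereal_sup (range (fun t : R => opnorm (B eta (Theta theta t w)))))).
  by apply: ereal_sup_ubound; exists t.
by apply: ltW; near: eta; exact: cvge0_lt.
Unshelve. all: by end_near. Qed.

Lemma nonlinear_perturbation_near (h : R -> R * Omega -> X -> X) (h0 : X -> X)
    (rho e : R) :
  ereal_sup [set (`|h eta (Theta theta p.1 w) p.2 - h0 p.2|%R%:E
                     + opnorm (fun x => ('d (h eta (Theta theta p.1 w)) (p.2 : X) x
                                         - 'd h0 (p.2 : X) x)%R))%E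
               | p in [set p : R * X | `|p.2| <= rho]]
       @[eta --> (0 : R)^'+] --> (0 : \bar R) -> 0 < e ->
  \forall eta \near (0 : R)^'+, forall t z, `|z| <= rho ->
    `|h eta (Theta theta t w) z - h0 z| <= e /\
    forall v, `|'d (h eta (Theta theta t w)) z v - 'd h0 z v| <= e * `|v|.
Proof.
move=> hlim e0; near=> eta => t z zr.
have hs : ((`|h eta (Theta theta t w) z - h0 z|%R%:E +
    opnorm (fun x => ('d (h eta (Theta theta t w)) (z : X) x - 'd h0 (z : X) x)%R))
    <= e%:E)%E.
  apply: (@le_trans _ _ (ereal_sup [set (`|h eta (Theta theta p.1 w) p.2 - h0 p.2|%R%:E
                     + opnorm (fun x => ('d (h eta (Theta theta p.1 w)) (p.2 : X) x
                                         - 'd h0 (p.2 : X) x)%R))%E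
               | p in [set p : R * X | `|p.2| <= rho]])).
    by apply: ereal_sup_ubound; exists (t, z).
  by apply: ltW; near: eta; exact: cvge0_lt.
split=> [|v].
  by rewrite -lee_fin (le_trans _ hs)// leeDl// opnorm_ge0.
have lin : linear (fun x => 'd (h eta (Theta theta t w)) z x - 'd h0 z x).
  by apply: linear_map_sub; exact: linearP.
apply: (le_opnorm lin _ v).
by rewrite (le_trans _ hs)// leeDr// lee_fin.
Unshelve. all: by end_near. Qed.

End orbit_limits.

Section autonomous_flows.
Context {R : realType} {d : measure_display} {Omega : measurableType d}.
Context {X : completeNormedModType R}.
Variables (theta : R -> Omega -> Omega) (T : R -> X -> X).
Hypothesis flow : random_flow theta.

Lemma linear_part_unperturbed B phi (w : R * Omega) t x :
  (forall t, 0 <= t -> linear (T t)) -> (forall w z, B w z = 0) ->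
  linear_part theta T B phi -> 0 <= t -> phi t w x = T t x.
Proof.
move=> linT B0 hphi t0; apply/eqP; rewrite -subr_eq0 -normr_le0 -[_ - _]subr0.
have [_ hu] := linear_part_duhamel flow w x t hphi.
have muE : (lebesgue_measure (`[0%R, t]%classic : set R) < +oo)%E.
  by rewrite lebesgue_measure_itv /=; case: ifP => _; rewrite ?ltry.
rewrite -(mul0r (fine (lebesgue_measure (`[0, t]%classic : set R)))).
apply: (bochner_dist_le _ muE (lexx 0) (hu t t0 (lexx t)) (bochner0 _)) => //.
move=> r; rewrite /= in_itv /= => /andP[_ rt].
by rewrite B0 subr0 (linear_map0 (linT _ _)) ?normr0// subr_ge0.
Qed.

Lemma mild_autonomous B h psi h0 (v v' : R * Omega) t x :
  (forall w z, B w z = 0) -> (forall w z, h w z = h0 z) ->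
  mild_well_posed theta T B h psi -> 0 <= t -> psi t v x = psi t v' x.
Proof.
move=> B0 hE wp t0; have [[cu hu] _] := wp v x; have [_ uniq] := wp v' x.
apply: (uniq (fun t => psi t v x)) => //; split=> // s s0.
by apply: is_bochner_integral_eq (hu s s0) => r _; rewrite !B0 !hE.
Qed.

End autonomous_flows.

(** How small the perturbation must be for a time step to be close to the
    unperturbed one in the sense of [near_map] and [near_map_on_ball]. *)
Lemma step_constant (R : realType) (p K tau : R) : 1 <= p -> 1 <= K -> 0 < tau ->
  exists eps : R, [/\ 0 < eps, 2 * K * tau * eps <= 1 &
    2 * K ^+ 2 * tau * eps <= (64 * p)^-1].
Proof.
move=> p1 K1 tau0.
have p0 : 0 < p by exact: lt_le_trans p1.
have K0 : 0 < K by exact: lt_le_trans K1.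
exists (128 * p * K ^+ 2 * tau)^-1; split.
- by rewrite invr_gt0 !mulr_gt0// exprn_gt0.
- have -> : 2 * K * tau * (128 * p * K ^+ 2 * tau)^-1 = (64 * p * K)^-1.
    by field; rewrite !gt_eqF.
  rewrite invf_le1 ?mulr_gt0// mulr_ege1// mulr_ege1//; lra.
apply: le_of_eq; field.
by rewrite !gt_eqF.
Qed.

Section perturbation.
Context {R : realType} {d : measure_display} {Omega : measurableType d}.
Context {X : completeNormedModType R}.
Variables (theta : R -> Omega -> Omega) (T : R -> X -> X).
Variables (B h : R -> R * Omega -> X -> X) (h0 : X -> X).
Variables (phi psi : R -> R -> R * Omega -> X -> X) (Pi0 J : X -> X).
Hypothesis flow : random_flow theta.
Hypothesis hT : C0_semigroup T.
Hypothesis hB : forall (eta : R) w, 0 <= eta <= 1 -> bounded_linear (B eta w).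
Hypothesis hB0 : forall w x, B 0 w x = 0.
Hypothesis hBlim : forall w,
  ereal_sup (range (fun t : R => opnorm (B eta (Theta theta t w))))
    @[eta --> (0 : R)^'+] --> (0 : \bar R).
Hypothesis hC1 : forall (eta : R) w, 0 <= eta <= 1 -> C1 (h eta w).
Hypothesis hh0 : forall (eta : R) w, 0 <= eta <= 1 -> h eta w 0 = 0.
Hypothesis h0E : forall w x, h 0 w x = h0 x.
Hypothesis hhlim : forall (r : R) w, 0 < r ->
  ereal_sup [set (`|h eta (Theta theta p.1 w) p.2 - h0 p.2|%R%:E
                  + opnorm (fun x => ('d (h eta (Theta theta p.1 w)) (p.2 : X) x
                                      - 'd h0 (p.2 : X) x)%R))%E
            | p in [set p : R * X | `|p.2| <= r]]
    @[eta --> (0 : R)^'+] --> (0 : \bar R).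
Hypothesis hphi : forall eta : R, 0 <= eta <= 1 ->
  linear_part theta T (B eta) (phi eta).
Hypothesis hpsi : forall eta : R, 0 <= eta <= 1 ->
  mild_well_posed theta T (B eta) (h eta) (psi eta) /\ cocycle theta (psi eta).
Hypothesis hyp0 : exp_dichotomy (fun t s : R => T (t - s)) (fun=> Pi0).

Variables (p tau K eps rho : R).
Hypothesis tau0 : 0 < tau.
Hypothesis K1 : 1 <= K.
Hypothesis hyp : hyperbolic_map (T tau) Pi0 J p.
Hypothesis Tle : forall t x, 0 <= t -> t <= tau -> `|T t x| <= K * `|x|.
Hypothesis eps0 : 0 < eps.
Hypothesis small1 : 2 * K * tau * eps <= 1.
Hypothesis small2 : 2 * K ^+ 2 * tau * eps <= (64 * p)^-1.
Hypothesis rho0 : 0 < rho.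
Hypothesis h0C1 : C1 h0.
Hypothesis hrho : forall z v, `|z| <= rho -> `|'d h0 z v| <= eps / 3 * `|v|.

Let p0 : 0 < p. Proof. exact: lt_le_trans (hyp_p1 hyp). Qed.
Let K0 : 0 < K. Proof. exact: lt_le_trans K1. Qed.
Let linT t : 0 <= t -> linear (T t). Proof. exact: semigroup_linear hT t. Qed.
Let u0 : 0 <= (0 : R) <= 1. Proof. by rewrite lexx ler01. Qed.
Let e3 : eps / 3 + 2 * (eps / 3) = eps. Proof. by field. Qed.
Let e0 : 0 < eps / 3. Proof. by rewrite divr_gt0. Qed.
Let e3le : eps / 3 <= eps. Proof. by rewrite -[leRHS]e3 lerDl mulr_ge0// ltW. Qed.
Let K21 : 1 <= 2 * K. Proof. by rewrite mulr_ege1// ler1n. Qed.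

Definition tame w eta :=
  (forall t z, `|B eta (Theta theta t w) z| <= eps / 3 * `|z|) /\
  (forall t z z', `|z| <= rho -> `|z'| <= rho ->
     `|h eta (Theta theta t w) z - h eta (Theta theta t w) z'| <=
       2 * (eps / 3) * `|z - z'|).

Lemma tame0 w : tame w 0.
Proof.
split=> [t z|t z z' zr zr']; first by rewrite hB0 normr0 mulr_ge0// ltW.
have -> : h 0 (Theta theta t w) = h0 by exact/funext.
rewrite (le_trans (mean_value_ball h0C1.1 hrho zr zr'))// ler_wpM2r//.
by rewrite mulr_natl mulr2n lerDl ltW.
Qed.

Lemma tame_Theta s w eta : tame (Theta theta s w) eta = tame w eta.
Proof.
apply/propext; rewrite /tame; split=> -[g1 g2]; split=> t.
- by move=> z; have := g1 (t - s) z; rewrite (ThetaD flow) subrK.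
- by move=> z z'; have := g2 (t - s) z z'; rewrite (ThetaD flow) subrK.
- by move=> z; rewrite (ThetaD flow).
- by move=> z z'; rewrite (ThetaD flow); exact: g2.
Qed.

Lemma tame_near w : \forall eta \near (0 : R)^'+, tame w eta.
Proof.
have nB := linear_perturbation_near hB (hBlim w) e0.
have nh := nonlinear_perturbation_near (hhlim w rho0) e0.
near=> eta; split; first by near: eta.
have eta01 : 0 <= eta <= 1 by near: eta; exact: at_right0_unit.
have dh : forall t z, `|z| <= rho -> `|h eta (Theta theta t w) z - h0 z| <= eps / 3 /\
    forall v, `|'d (h eta (Theta theta t w)) z v - 'd h0 z v| <= eps / 3 * `|v|.
  by near: eta.
move=> t z z'; apply: mean_value_ball; first by have [] := hC1 (Theta theta t w) eta01.
move=> x v xr; have [_ /(_ v) h1] := dh t x xr; have h2 := hrho v xr.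
rewrite -['d _ x v](subrK ('d h0 x v)) (le_trans (ler_normD _ _))//.
rewrite (le_trans (lerD h1 h2))//; apply: le_of_eq; ring.
Unshelve. all: by end_near. Qed.

(** The threshold depends on [w] only through the property [tame], which is the
    same all along the orbit of [w]. *)
Lemma tame_threshold : exists eta0 : R * Omega -> R,
  Theta_invariant theta eta0 /\ forall w, 0 < eta0 w <= 1 /\
    forall eta, 0 < eta <= eta0 w -> tame w eta.
Proof.
pose E w := [set x : R | 0 < x <= 1 /\ forall eta, 0 < eta <= x -> tame w eta].
exists (fun w => get (E w)); split=> [s w|w]; last first.
  by apply: (@getPex _ (E w)); exact: at_right0_exists (tame_near w).
congr get; apply/seteqP.
by split=> x /= [x01 gx]; split=> // eta /gx; rewrite tame_Theta.
Qed.

Let r := rho / (4 * K).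
Let S eta w := process theta (phi eta) w.
Let N eta w := process theta (psi eta) w.

Lemma tame_near_map w eta : 0 <= eta <= 1 -> tame w eta ->
  near_map (T tau) p tau (2 * K) (S eta w).
Proof.
move=> eta01 [gB _].
have small2' : 2 * K ^+ 2 * tau * eps <= (32 * p)^-1.
  rewrite (le_trans small2)// lef_pV2 ?posrE ?mulr_gt0// ler_pM2r// ler_nat//.
apply: (linear_part_near_map flow tau0 K1 linT Tle (hphi eta01)
  _ (ltW eps0) small1 small2') => t z.
by rewrite (le_trans (gB t z))// ler_wpM2r ?e3le.
Qed.

Let F eta w t z := B eta (Theta theta t w) z + h eta (Theta theta t w) z.

Let F0 eta w t : 0 <= eta <= 1 -> F eta w t 0 = 0.
Proof.
move=> eta01; rewrite /F hh0// addr0.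
by have [lB _] := hB (Theta theta t w) eta01; exact: (linear_map0 lB).
Qed.

Let Flip eta w t z z' : 0 <= eta <= 1 -> tame w eta -> `|z| <= rho ->
  `|z'| <= rho -> `|F eta w t z - F eta w t z'| <= eps * `|z - z'|.
Proof.
move=> eta01 [gB gh] zr zr'; have [lB _] := hB (Theta theta t w) eta01.
have -> : F eta w t z - F eta w t z' = B eta (Theta theta t w) (z - z') +
    (h eta (Theta theta t w) z - h eta (Theta theta t w) z').
  by rewrite /F (linear_mapB lB); zmod_identity.
rewrite (le_trans (ler_normD _ _))// (le_trans (lerD (gB _ _) (gh _ _ _ zr zr')))//.
by rewrite -mulrDl e3.
Qed.

Lemma tame_near_map_on_ball w eta : 0 <= eta <= 1 -> tame w eta ->
  near_map_on_ball (T tau) p tau (2 * K) r (N eta w).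
Proof.
move=> eta01 g; have [wp coc] := hpsi eta01.
exact: (mild_near_map_on_ball flow tau0 K1 linT Tle wp coc rho0 (ltW eps0)
  small1 (fun t => F0 w t eta01)
  (fun t z z' zr zr' => Flip t eta01 g zr zr') small2).
Qed.

Let ST w s t x : s <= t -> S 0 w t s x = T (t - s) x.
Proof.
move=> st; apply: (linear_part_unperturbed flow _ _ linT hB0 (hphi u0)).
by rewrite subr_ge0.
Qed.

Let Pi eta w := unstable_proj (T tau) tau (S eta w).
Let Sigma eta w := unstable_graph (T tau) tau r (S eta w) (N eta w).

Lemma unstable_proj0 w s : Pi 0 w s = Pi0.
Proof.
exact: (unstable_proj_autonomous hT hyp0 hyp tau0 K21 s
  (tame_near_map u0 (tame0 w)) (ST w)).
Qed.

Lemma unstable_graph0 w s : Sigma 0 w s = Sigma 0 w 0.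
Proof.
apply/funext => z; rewrite /Sigma /unstable_graph /glued_orbit.
rewrite -/(Pi 0 w s z) -/(Pi 0 w 0 z) !unstable_proj0.
congr (get (kicked_orbit _ _ _) _); apply/funext => k; apply/funext => x.
have tE t : t + tau - t = tau by ring.
have tS t : t <= t + tau by rewrite lerDl ltW.
rewrite /glued_deviation /deviation !gridS !(ST w x (tS _)) /N /process !tE.
have [wp _] := hpsi u0.
by rewrite (mild_autonomous _ (Theta theta (grid tau 0 k) w) _ hB0 h0E wp (ltW tau0)).
Qed.

(** Uniformly in the initial time, which is what convergence of the projections
    and of the graphs rests on. *)
Lemma step_near w e : 0 < e -> \forall eta \near (0 : R)^'+,
  [/\ 0 <= eta <= 1, tame w eta,
      forall s x, `|S eta w (s + tau) s x - S 0 w (s + tau) s x| <= e * `|x| &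
      forall s x, `|x| <= r ->
        `|N eta w (s + tau) s x - N 0 w (s + tau) s x| <= e].
Proof.
move=> e_gt0; pose D := 2 * K ^+ 2 * tau * (rho + 1).
have D0 : 0 < D by rewrite /D !mulr_gt0// ?exprn_gt0// addr_gt0.
pose b := Num.min eps (e / D).
have b0 : 0 < b by rewrite lt_min eps0 divr_gt0.
have be : b <= eps by rewrite ge_min lexx.
have bD : D * b <= e by rewrite mulrC -ler_pdivlMr// ge_min lexx orbT.
have nB := linear_perturbation_near hB (hBlim w) b0.
have nh := nonlinear_perturbation_near (hhlim w rho0) b0.
near=> eta.
have eta01 : 0 <= eta <= 1 by near: eta; exact: at_right0_unit.
have g : tame w eta by near: eta; exact: tame_near.
have hBb : forall t z, `|B eta (Theta theta t w) z| <= b * `|z| by near: eta.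
have hb : forall t z, `|z| <= rho -> `|h eta (Theta theta t w) z - h0 z| <= b /\
    forall v, `|'d (h eta (Theta theta t w)) z v - 'd h0 z v| <= b * `|v|.
  by near: eta.
have q0 : 0 <= 2 * tau * b by rewrite mulr_ge0 ?ltW// mulr_gt0.
split=> // [s x|s x xr].
  have ss : s <= s + tau by rewrite lerDl ltW.
  rewrite (ST w x ss) /S /process (_ : s + tau - s = tau); last by ring.
  have smallb : 2 * K * tau * b <= 1.
    by rewrite (le_trans _ small1)// ler_wpM2l// !mulr_ge0// ltW.
  have [_ h1] := linear_part_near flow tau0 K1 linT Tle (hphi eta01) hBb
    (ltW b0) smallb s x (ltW tau0) (lexx tau).
  rewrite (le_trans h1)// ler_wpM2r// (le_trans _ bD)//.
  have -> : D * b = K ^+ 2 * (2 * tau * b) * (rho + 1) by rewrite /D; ring.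
  have -> : 2 * K ^+ 2 * tau * b = K ^+ 2 * (2 * tau * b) by ring.
  by rewrite ler_peMr ?lerDr ?(ltW rho0)// mulr_ge0// sqr_ge0.
have [wp coc] := hpsi eta01; have [wp0 coc0] := hpsi u0.
have kap0 : 0 <= b * (rho + 1) by rewrite mulr_ge0 ?addr_ge0 ?ltW.
have := mild_close flow tau0 K1 linT Tle wp coc wp0 coc0 rho0
  (ltW eps0) (ltW eps0) kap0 small1 small1
  (fun t => F0 w t eta01) (fun t => F0 w t u0)
  (fun t z z' zr zr' => Flip t eta01 g zr zr')
  (fun t z z' zr zr' => Flip t u0 (tame0 w) zr zr') _ s xr.
move=> /(_ _)/le_trans; apply; last first.
  rewrite (le_trans _ bD)//.
  have -> : 2 * K * tau * (b * (rho + 1)) = K * (2 * tau * b * (rho + 1)) by ring.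
  have -> : D * b = K ^+ 2 * (2 * tau * b * (rho + 1)) by rewrite /D; ring.
  have q1 : 0 <= 2 * tau * b * (rho + 1) by rewrite mulr_ge0// addr_ge0// ltW.
  by rewrite ler_wpM2r// expr2 ler_peMl// ltW.
move=> t z zr; rewrite hB0 add0r h0E.
have [hz _] := hb t z zr; have Bz := hBb t z.
have -> (x1 x2 x3 : X) : x1 + x2 - x3 = x1 + (x2 - x3) by zmod_identity.
rewrite (le_trans (ler_normD _ _))// (le_trans (lerD Bz hz))//.
by rewrite mulrDr mulr1 lerD2r ler_wpM2l// ltW.
Unshelve. all: by end_near. Qed.

Lemma unstable_proj_near w e : 0 < e -> \forall eta \near (0 : R)^'+,
  forall t, (opnorm (fun x => (Pi eta w t x - Pi0 x)%R) <= e%:E)%E.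
Proof.
move=> e_gt0; have q0 : 0 < 16 * p ^+ 2 by rewrite mulr_gt0// exprn_gt0.
have := step_near w (divr_gt0 e_gt0 q0).
apply: filterS => eta [eta01 g dS _] t; apply: opnorm_le; first exact: ltW.
move=> x; rewrite -(unstable_proj0 w t).
have := unstable_proj_close hyp tau0 t x (tame_near_map eta01 g)
  (tame_near_map u0 (tame0 w)) dS.
by rewrite [16 * _ * _]mulrC divfK ?gt_eqF.
Qed.

Lemma unstable_graph_near w e : 0 < e -> \forall eta \near (0 : R)^'+,
  forall t z, `|z| <= r ->
    `|Sigma eta w t (Pi eta w t z) - Sigma 0 w t (Pi 0 w t z)| <= e.
Proof.
move=> e_gt0.
have r0 : 0 < r by rewrite divr_gt0// mulr_gt0.
have p3 : 0 < p ^+ 3 by rewrite exprn_gt0.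
have q0 : 0 < 128 * p ^+ 3 * (1 + r) by rewrite !mulr_gt0// addr_gt0.
have c0 := divr_gt0 e_gt0 q0; have := step_near w c0.
apply: filterS => eta [eta01 g dS dN] t z zr.
have nS := tame_near_map eta01 g; have nS0 := tame_near_map u0 (tame0 w).
have nN := tame_near_map_on_ball eta01 g.
have nN0 := tame_near_map_on_ball u0 (tame0 w).
rewrite /Sigma (unstable_graph_proj r hyp tau0 K21 _ nS).
rewrite (unstable_graph_proj r hyp tau0 K21 _ nS0).
have := unstable_graph_close hyp tau0 r0 t z nS nS0 nN nN0 (ltW c0) dS dN.
move=> /le_trans; apply; set c := e / _ in c0 *.
have -> : e = 128 * p ^+ 3 * c * (1 + r).
  by rewrite /c; field; rewrite (gt_eqF p0) gt_eqF// addr_gt0.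
by apply: ler_wpM2l; [exact: mulr_ge0 (mulr_ge0 _ (ltW p3)) (ltW c0)|rewrite lerD2l].
Qed.

Lemma unstable_graph_local w eta dlt : 0 <= eta <= 1 -> tame w eta ->
  0 < dlt < r -> exists dlt' dlt'' : R,
  [/\ 0 < dlt'', dlt'' < dlt', dlt' < dlt & forall s,
    graph_over (Pi eta w s) (Sigma eta w s) dlt''
      `<=` local_unstable_set (N eta w) dlt' s /\
    local_unstable_set (N eta w) dlt' s
      `<=` graph_over (Pi eta w s) (Sigma eta w s) dlt].
Proof.
move=> eta01 g /andP[dlt0 dltr].
have r0 : 0 < r := lt_trans dlt0 dltr.
have nS := tame_near_map eta01 g; have nN := tame_near_map_on_ball eta01 g.
have KC : 1 < 2 * K * (2 * p * (1 + 2 * p)).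
  by have h1 := hyp_p1 hyp; have h2 := K1; nra.
have d2 : 0 < dlt / 2 by rewrite divr_gt0.
have d2lt : dlt / 2 < dlt by rewrite ltr_pdivrMr// ltr_pMr// ltr1n.
exists (dlt / 2), (dlt / 2 / (2 * K * (2 * p * (1 + 2 * p)))); split=> //.
- by rewrite divr_gt0// (lt_trans ltr01).
- by rewrite ltr_pdivrMr ?(lt_trans ltr01 KC)// ltr_pMr.
move=> s; have d2r := ltW (lt_trans d2lt dltr).
split; first exact: (graph_sub_local_unstable hyp tau0 K21 r0 nS nN d2 d2r).
apply: (subset_trans (local_unstable_sub_graph hyp tau0 K21 r0 nS nN d2r)).
by move=> _ [z zd <-]; exists z => //=; rewrite (le_trans zd)// ltW.
Qed.

End perturbation.

Theorem theorem4p5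
  (R : realType) (d : measure_display) (Omega : measurableType d)
  (P : probability Omega R)
  (theta : R -> Omega -> Omega) (htheta : random_flow theta)
  (X : completeNormedModType R) (hX : separable_space X)
  (domA : set X) (A : X -> X) (T : R -> X -> X)
  (hT : C0_semigroup T) (hA : generator domA A T)
  (B : R -> R * Omega -> X -> X)
  (hB : forall (eta : R) w, 0 <= eta <= 1 -> bounded_linear (B eta w))
  (hB0 : forall w x, B 0 w x = 0)
  (hBlim : forall w,
     ereal_sup (range (fun t : R => opnorm (B eta (Theta theta t w))))
       @[eta --> (0 : R)^'+] --> (0 : \bar R))
  (h : R -> R * Omega -> X -> X)
  (hC1 : forall (eta : R) w, 0 <= eta <= 1 -> C1 (h eta w))
  (hh0 : forall (eta : R) w, 0 <= eta <= 1 -> h eta w 0 = 0)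
  (hdh0 : forall (eta : R) w, 0 <= eta <= 1 ->
     forall x, 'd (h eta w) (0 : X) x = 0)
  (h0 : X -> X) (h0E : forall w x, h 0 w x = h0 x)
  (hhlim : forall (r : R) w, 0 < r ->
     ereal_sup [set (`|h eta (Theta theta p.1 w) p.2 - h0 p.2|%R%:E
                     + opnorm (fun x => ('d (h eta (Theta theta p.1 w)) (p.2 : X) x
                                         - 'd h0 (p.2 : X) x)%R))%E
               | p in [set p : R * X | `|p.2| <= r]]
       @[eta --> (0 : R)^'+] --> (0 : \bar R))
  (phi : R -> R -> R * Omega -> X -> X)
  (hphi : forall eta : R, 0 <= eta <= 1 ->
     linear_part theta T (B eta) (phi eta))
  (psi : R -> R -> R * Omega -> X -> X)
  (hpsi : forall eta : R, 0 <= eta <= 1 ->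
     mild_well_posed theta T (B eta) (h eta) (psi eta) /\
     cocycle theta (psi eta))
  (Pi0 : X -> X)
  (hyp0 : exp_dichotomy (fun t s : R => T (t - s)) (fun=> Pi0)) :
  exists2 eps : R, 0 < eps & forall eps0 : R, 0 < eps0 < eps ->
  exists (eta0 : R * Omega -> R) (Pi : R -> R * Omega -> R -> X -> X)
         (delta0 : R * Omega -> R)
         (Sigma : R -> R * Omega -> R -> X -> X) (Sigma0 : R * Omega -> X -> X),
  [/\ (* (1) *)
      [/\ Theta_invariant theta eta0,
          forall w, 0 < eta0 w <= 1,
          forall w s, Pi 0 w s = Pi0
        & forall w eta, 0 < eta <= eta0 w ->
            exp_dichotomy (process theta (phi eta) w) (Pi eta w)],
      (* (2) *)
      forall w,
        ereal_sup (range (fun t : R => opnorm (fun x => Pi eta w t x - Pi0 x)))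
          @[eta --> (0 : R)^'+] --> (0 : \bar R),
      (* (3) *)
      [/\ Theta_invariant theta delta0,
          forall w, 0 < delta0 w,
          forall w s, Sigma 0 w s = Sigma0 w
        & forall w eta, 0 <= eta <= eta0 w ->
          [/\ forall s z, `|z| <= delta0 w ->
                Sigma eta w s z = Sigma eta w s (Pi eta w s z),
              forall s z, `|z| <= delta0 w ->
                range (fun x => x - Pi eta w s x) (Sigma eta w s z)
            & forall delta, 0 < delta < delta0 w ->
                exists delta' delta'' : R,
                [/\ 0 < delta'', delta'' < delta', delta' < delta
                  & forall s,
                    graph_over (Pi eta w s) (Sigma eta w s) delta''
                      `<=` local_unstable_set (process theta (psi eta) w)
                             delta' s /\
                    local_unstable_set (process theta (psi eta) w) delta' s
                      `<=` graph_over (Pi eta w s) (Sigma eta w s) delta]]]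
    & (* (4) *)
      forall w (s : R),
        ereal_sup [set (opnorm (fun x => (Pi eta w p.1 x - Pi0 x)%R)
                        + `|Sigma eta w p.1 (Pi eta w p.1 p.2)
                            - Sigma0 w (Pi0 p.2)|%R%:E)%E
                  | p in [set p : R * X | p.1 <= s /\ `|p.2| <= delta0 w]]
          @[eta --> (0 : R)^'+] --> (0 : \bar R)].
Proof.
have [w0 _] : exists w : R * Omega, True.
  have [x0 _] : [set: Omega] !=set0.
    apply/set0P/eqP => O0; have := probability_setT P.
    by rewrite O0 measure0 => /eqP; rewrite eqe eq_sym oner_eq0.
  by exists (0, x0).
have u0 : 0 <= (0 : R) <= 1 by rewrite lexx ler01.
have h0_E w : h 0 w = h0 by apply/funext.
have h0C1 : C1 h0 by rewrite -(h0_E w0); exact: hC1.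
have dh0 v : 'd h0 (0 : X) v = 0 by rewrite -(h0_E w0); exact: hdh0.
have [tau [p [K [J [tau0 K1 hyp Tle]]]]] := hyperbolic_time_step hT hyp0.
have p1 := hyp_p1 hyp.
have K21 : 1 <= 2 * K by rewrite mulr_ege1// ler1n.
have [eps [eps0 small1 small2]] := step_constant p1 K1 tau0.
have e0 : 0 < eps / 3 by rewrite divr_gt0.
have [rho rho0 hrho] := C1_small_derivative h0C1 dh0 e0.
(* solutions from the ball of this radius stay in the one of radius rho *)
have r0 : 0 < rho / (4 * K) by rewrite divr_gt0// mulr_gt0// (lt_le_trans ltr01).
have [eta0 [eta0T eta0P]] :=
  tame_threshold htheta hB hBlim hC1 hhlim eps0 rho0 hrho.
have tm0 := tame0 theta hB0 h0E eps0 h0C1 hrho.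
have near_lin := tame_near_map htheta hT hphi tau0 K1 hyp Tle eps0 small1 small2.
have near_ball := tame_near_map_on_ball htheta hT hB hh0 hpsi tau0 K1 Tle eps0
  small1 small2 rho0.
pose S eta w := process theta (phi eta) w.
pose Pi eta w := unstable_proj (T tau) tau (S eta w).
pose Sigma eta w := unstable_graph (T tau) tau (rho / (4 * K)) (S eta w)
  (process theta (psi eta) w).
have pi0 w s : Pi 0 w s = Pi0.
  exact: (unstable_proj0 htheta hT hB0 h0E hphi hyp0 tau0 K1 hyp Tle eps0
    small1 small2 h0C1 hrho).
have sigma0 w s : Sigma 0 w s = Sigma 0 w 0.
  exact: (unstable_graph0 htheta hT hB0 h0E hphi hpsi hyp0 tau0 K1 hyp Tle eps0
    small1 small2 h0C1 hrho).
have pi_near w e : 0 < e -> \forall eta \near (0 : R)^'+,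
    forall t, (opnorm (fun x => (Pi eta w t x - Pi0 x)%R) <= e%:E)%E.
  exact: (unstable_proj_near htheta hT hB hB0 hBlim hC1 hh0 h0E hhlim hphi hpsi
    hyp0 tau0 K1 hyp Tle eps0 small1 small2 rho0 h0C1 hrho).
have sigma_near w e : 0 < e -> \forall eta \near (0 : R)^'+,
    forall t z, `|z| <= rho / (4 * K) ->
      `|Sigma eta w t (Pi eta w t z) - Sigma 0 w t (Pi 0 w t z)| <= e.
  exact: (unstable_graph_near htheta hT hB hB0 hBlim hC1 hh0 h0E hhlim hphi hpsi
    tau0 K1 hyp Tle eps0 small1 small2 rho0 h0C1 hrho).
have graph_local := unstable_graph_local htheta hT hB hh0 hphi hpsi tau0 K1 hyp
  Tle eps0 small1 small2 rho0.
have small_eta w eta : 0 <= eta <= eta0 w -> 0 <= eta <= 1 /\ tame theta B h eps rho w eta.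
  move=> /andP[eta_ge0 eta_le]; have [/andP[_ eta01] tm] := eta0P w.
  split; first by rewrite eta_ge0 (le_trans eta_le).
  have [->|eta_neq0] := eqVneq eta 0; first exact: tm0.
  by apply: tm; rewrite lt_neqAle eq_sym eta_neq0 eta_ge0.
exists 1 => // eps' _.
exists eta0, Pi, (fun=> rho / (4 * K)), Sigma, (fun w => Sigma 0 w 0).
split; first split=> //.
- by move=> w; have [] := eta0P w.
- move=> w eta /andP[/ltW eta_ge0 eta_le].
  have [eta01 tm] := small_eta w eta (introT andP (conj eta_ge0 eta_le)).
  exact: (near_map_dichotomy hyp tau0 K21 (near_lin _ _ _ _ eta01 tm)).
- move=> w; apply: cvge0_of_le => [eta|e e_gt0].
    apply: le_trans (ereal_sup_ubound _); last by exists 0.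
    exact: opnorm_ge0.
  apply: filterS (pi_near w e e_gt0) => eta he.
  by apply: ge_ereal_sup => _ [t _ <-].
- split=> // w eta /small_eta[eta01 tm].
  have nS := near_lin _ _ _ _ eta01 tm; have nN := near_ball _ _ eta01 tm.
  split.
  + by move=> s z _; rewrite /Sigma (unstable_graph_proj _ hyp tau0 K21 _ nS).
  + by move=> s z _; exact: (unstable_graph_range hyp tau0 K21 r0 nS nN).
  by move=> dlt dltP; exact: graph_local _ _ _ eta01 tm dltP.
- move=> w s; apply: cvge0_of_le => [eta|e e_gt0].
    apply: le_trans (ereal_sup_ubound _); last first.
      by exists (s, 0) => //=; split=> //; rewrite normr0 ltW.
    by rewrite adde_ge0 ?opnorm_ge0.
  have e2 : 0 < e / 2 by rewrite divr_gt0.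
  apply: filterS2 (pi_near w _ e2) (sigma_near w _ e2) => eta hPi hSigma.
  apply: ge_ereal_sup => _ [[t z] /= [_ zr] <-].
  rewrite [e]splitr EFinD leeD// lee_fin -(sigma0 w t) -(pi0 w t).
  exact: hSigma.
Qed.
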